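(* Let $\alpha\in\mathbb{R}\setminus\mathbb{Q}$, let $A\in GL(2,\mathbb{Z})$ be hyperbolic, let $h=\begin{pmatrix}h_1\\ h_2\end{pmatrix}\in C(\mathbb{T},\mathbb{T}^2)$, and let $$\varphi:\mathbb{T}\times\mathbb{T}^2\to\mathbb{T}\times\mathbb{T}^2,\qquad (\omega,x)\mapsto(\omega+\alpha \bmod 1,\ Ax+h(\omega)).$$ Let $m\in\mathbb{N}$ be the smallest positive integer satisfying $$m\cdot(I-A)^{-1}\begin{pmatrix}\deg(h_1)\\ \deg(h_2)\end{pmatrix}\in\mathbb{Z}^2.$$ Then: (1) $\mathcal{G}(\varphi)=\bigcup_{n\in\mathbb{N}}\mathcal{G}(\varphi;n,m)$; (2) $\sharp\,\mathcal{G}(\varphi;n,m)<+\infty$ for all $n\in\mathbb{N}$; (3) $\lim_{n\to+\infty}\frac1n\log\sharp\,\mathcal{G}(\varphi;n,m)=h_{top}(\varphi)$.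
   Context: $\mathbb{T}=\mathbb{R}/\mathbb{Z}$, $\mathbb{N}$ is the set of positive integers, $C(\mathbb{T},\mathbb{T}^2)$ is the space of continuous maps $\mathbb{T}\to\mathbb{T}^2$, $GL(2,\mathbb{Z})$ is the group of invertible integer $2\times2$ matrices (with integer inverse), and $A$ hyperbolic means that no eigenvalue of $A$ has modulus $1$ (so $I-A$ is invertible over $\mathbb{R}$). For a continuous $f:\mathbb{T}\to\mathbb{T}$, $\deg(f)\in\mathbb{Z}$ is its topological degree. $\sharp$ denotes cardinality and $h_{top}$ topological entropy. Definition ($\varphi^n$-invariant torus). Let $m,n\in\mathbb{N}$ and let $g:\mathbb{R}\to\mathbb{T}^2$ be a continuous map such that for every $\omega\in\mathbb{R}$: (1) $g(\omega)=g(\omega+km)$ for every $k\in\mathbb{Z}$; (2) $\varphi^n(\omega \bmod 1,g(\omega))=(\omega+n\alpha \bmod 1,\ g(\omega+n\alpha))$; (3) $g(\omega),g(\omega+1),\dots,g(\omega+m-1)$ are pairwise distinct. The graph $\mathcal{T}=\{(\omega,g_{\mathcal{T}}(\omega)):\omega\in\mathbb{T}\}$ of the multi-valued map $g_{\mathcal{T}}:\omega\mapsto\{g(\omega+i): i\in\{0,\dots,m-1\}\}$ is called a $\varphi^n$-invariant torus of degree $m$. $\mathcal{G}(\varphi)$ is the collection of all invariant tori (all $\varphi^n$-invariant tori of any degree, for all $n\in\mathbb{N}$). $\mathcal{G}(\varphi;n,m)$ is the collection of all tori of degree $m$ that are $\varphi^k$-invariant for some $k\le n$. *)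

(* Defs.v *)
From HB Require Import structures.
From mathcomp Require Import all_boot all_order all_algebra.
From mathcomp Require Import finmap ring_quotient complex.
From mathcomp Require Import all_classical all_reals all_analysis.
From mathcomp Require Import lra.

Set Implicit Arguments.
Unset Strict Implicit.
Unset Printing Implicit Defensive.

Import Order.TTheory GRing.Theory Num.Theory.
Import numFieldTopology.Exports numFieldNormedType.Exports.

Local Open Scope classical_set_scope.
Local Open Scope ring_scope.

(* [Num.int], as a subgroup of R, so that its quotient can be formed. *)
Definition int_subgroup (R : realType) : zmodClosed R :=
  GRing.ZmodClosed.clone R (@Num.int_num_subdef R) _.

Definition circle (R : realType) : Type := Quotient.quot (int_subgroup R).

HB.instance Definition _ (R : realType) := GRing.Zmodule.on (circle R).

Definition mod1 {R : realType} (x : R) : circle R :=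
  (\pi_(Quotient.quot (int_subgroup R)) x)%qT.

Section CircleTheory.
Context {R : realType}.
Implicit Types (x y : R) (a b c : circle R).

Lemma mod1_is_zmod_morphism : zmod_morphism (@mod1 R).
Proof. by move=> x y; rewrite /mod1 raddfB. Qed.

HB.instance Definition _ :=
  GRing.isZmodMorphism.Build R (circle R) (@mod1 R) mod1_is_zmod_morphism.

Lemma mod1_eq x y : (mod1 x == mod1 y) = (x - y \is a Num.int).
Proof. exact: esym (Quotient.idealrBE (int_subgroup R) x y). Qed.

Lemma mod1_surj a : exists x, mod1 x = a.
Proof. by exists (repr (a : Quotient.quot (int_subgroup R))); exact: reprK. Qed.


(* The distance to 0 in R / Z: the least `|x| over the representatives x. *)
Definition cnorm a : R := inf [set `|x| | x in [set x | mod1 x = a]].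

Lemma cnorm_le x : cnorm (mod1 x) <= `|x|.
Proof.
by apply: ge_inf; [exists 0 => _ [y _ <-]; exact: normr_ge0 | exists x].
Qed.

Lemma cnorm_attained a : exists2 x, mod1 x = a & cnorm a = `|x|.
Proof.
have [y <-] := mod1_surj a.
pose x := y - (Num.floor (y + 2^-1))%:~R.
have xy : mod1 x = mod1 y.
  by apply/eqP; rewrite mod1_eq /x addrAC subrr sub0r rpredN intr_int.
have x2 : `|x| <= 2^-1.
  have h1 := floor_le_tmp (y + 2^-1).
  have h2 := floorD1_gt (y + 2^-1).
  rewrite intrD1 in h2.
  by rewrite ler_norml /x; apply/andP; split; lra.
exists x => //; apply/eqP; rewrite eq_le -{1}xy cnorm_le /=.
apply: lb_le_inf; first by exists `|x|; exists x.
move=> _ [z /eqP zy <-]; move: zy; rewrite -xy mod1_eq => zxint.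
have [->//|zx] := eqVneq z x.
have := norm_intr_ge1 zxint; rewrite subr_eq0 => /(_ zx) h.
have := ler_normB z x; lra.
Qed.

Lemma cnorm0 : cnorm 0 = 0.
Proof.
apply/eqP; rewrite eq_le; apply/andP; split.
  by have := cnorm_le 0; rewrite raddf0 normr0.
by have [x _ ->] := cnorm_attained 0.
Qed.

Lemma cnorm_eq0 a : cnorm a = 0 -> a = 0.
Proof.
by have [x <- ->] := cnorm_attained a => /normr0_eq0 ->; rewrite raddf0.
Qed.

Lemma cnormN a : cnorm (- a) = cnorm a.
Proof.
suff h b : cnorm (- b) <= cnorm b.
  by apply/eqP; rewrite eq_le h /= -{1}[a]opprK h.
have [x <- ->] := cnorm_attained b.
by rewrite -raddfN -(normrN x) cnorm_le.
Qed.

Lemma cnormD a b : cnorm (a + b) <= cnorm a + cnorm b.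
Proof.
have [x <- ->] := cnorm_attained a; have [y <- ->] := cnorm_attained b.
by rewrite -raddfD (le_trans (cnorm_le _)) // ler_normD.
Qed.

Definition cdist a b : R := cnorm (b - a).

Lemma cdistxx a : cdist a a = 0. Proof. by rewrite /cdist subrr cnorm0. Qed.

Lemma cdist_positivity a b : cdist a b = 0 -> a = b.
Proof. by move/cnorm_eq0/eqP; rewrite subr_eq0 => /eqP. Qed.

Lemma cdist_sym a b : cdist a b = cdist b a.
Proof. by rewrite /cdist -opprB cnormN. Qed.

Lemma cdist_triangle b a c : cdist a c <= cdist a b + cdist b c.
Proof. by rewrite /cdist [leRHS]addrC -(subrKA b c) cnormD. Qed.

HB.instance Definition _ := @isMetric.Build R (circle R) cdist
  cdistxx cdist_positivity cdist_sym cdist_triangle.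

Lemma cballE a (e : R) : ball a e = [set b | cnorm (b - a) < e].
Proof. by rewrite ballEmdist. Qed.

Lemma mod1_continuous : continuous (@mod1 R).
Proof.
move=> x A /nbhs_ballP[e /= e0 eA]; apply/nbhs_ballP; exists e => //= y xy.
apply: eA; rewrite cballE /= -raddfB (le_lt_trans (cnorm_le _)) //.
by rewrite distrC.
Qed.

(* The topology of [cdist] is the quotient topology of R / Z. *)
Lemma circle_openE (U : set (circle R)) : open U <-> open (mod1 @^-1` U).
Proof.
split=> [|oU]; first by move/continuousP: mod1_continuous; exact.
rewrite openE => a; have [x <-] := mod1_surj a => Ux.
have /nbhs_ballP[e /= e0 eU] : nbhs x (mod1 @^-1` U) by exact: open_nbhs_nbhs.
apply/nbhs_ballP; exists e => //= b; rewrite cballE /= => be.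
have [z zb zE] := cnorm_attained (b - mod1 x).
have -> : b = mod1 (x + z) by rewrite raddfD /= zb addrC subrK.
by apply: eU; rewrite /ball /= opprD addNKr normrN -zE.
Qed.

End CircleTheory.

Section Degree.
Context {R : realType}.

(* [d] is the degree of [f] when some continuous lift [F] of [f] along
   [mod1] satisfies F (x + 1) = F x + d. *)
Definition has_degree (f : circle R -> circle R) (d : int) : Prop :=
  exists F : R -> R, [/\ continuous F,
    forall x, f (mod1 x) = mod1 (F x) &
    forall x, F (x + 1) = F x + d%:~R].

(* A continuous [f] has exactly one degree; 0 is a junk value otherwise. *)
Definition degree (f : circle R -> circle R) : int :=
  xget 0 [set d | has_degree f d].

End Degree.

Section Entropy.
Context {R : realType} {X : pseudoMetricType R}.
Local Open Scope ereal_scope.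

(* (n, e)-separated: distinct points of [E] are at distance at least [e] for
   the metric max_(i < n) d (f^i x) (f^i y). *)
Definition orbit_separated (f : X -> X) (n : nat) (e : R) (E : {fset X}) : Prop :=
  forall x y, x \in E -> y \in E ->
    (forall i, (i < n)%N -> ball (iter i f x) e (iter i f y)) -> x = y.

Definition max_separated (f : X -> X) (n : nat) (e : R) : \bar R :=
  ereal_sup [set (#|` E|%:R)%:E | E in [set E | orbit_separated f n e E]].

Definition entropy_at (f : X -> X) (e : R) : \bar R :=
  limn_esup (fun n => (n%:R^-1)%:E * lne (max_separated f n e)).

(* Bowen's topological entropy, for X compact and f continuous.
   [entropy_at f e] is nonincreasing in [e], so the supremum is the limit as
   e tends to 0. *)
Definition htop (f : X -> X) : \bar R :=
  ereal_sup [set entropy_at f e | e in [set e : R | (0 < e)%R]].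

End Entropy.

Notation torus2 R := 'cV[circle R]_2.

Section SkewProduct.
Context {R : realType}.
Implicit Types (alpha : R) (A : 'M[int]_2).

Definition hyperbolic A : Prop :=
  forall l : R[i], eigenvalue (map_mx intr A : 'M[R[i]]_2) l -> `|l| != 1.

Definition torus_action A (x : torus2 R) : torus2 R :=
  \col_i \sum_j x j 0 *~ A i j.

Definition skew_product alpha A (h : circle R -> torus2 R)
    (p : circle R * torus2 R) : circle R * torus2 R :=
  (p.1 + mod1 alpha, torus_action A p.2 + h p.1).

Definition component (h : circle R -> torus2 R) (i : 'I_2) : circle R -> circle R :=
  fun w => h w i 0.

(* (I - A)^-1 (deg h_1, deg h_2)^T *)
Definition degree_vector A (h : circle R -> torus2 R) : 'cV[R]_2 :=
  invmx (1%:M - map_mx intr A) *m \col_i (degree (component h i))%:~R.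

End SkewProduct.

Section InvariantTori.
Context {R : realType}.
Variables (alpha : R) (phi : circle R * torus2 R -> circle R * torus2 R).

Definition torus_parametrization (n m : nat) (g : R -> torus2 R) : Prop :=
  [/\ continuous g,
      forall (w : R) (k : int), g w = g (w + k%:~R * m%:R),
      forall w, iter n phi (mod1 w, g w) =
                (mod1 (w + n%:R * alpha), g (w + n%:R * alpha)) &
      forall (w : R) (i j : nat), (i < m)%N -> (j < m)%N ->
        g (w + i%:R) = g (w + j%:R) -> i = j].

Definition torus_graph (m : nat) (g : R -> torus2 R) :
    set (circle R * torus2 R) :=
  [set p | exists w : R, p.1 = mod1 w /\
           exists2 i : nat, (i < m)%N & p.2 = g (w + i%:R)].

Definition invariant_torus (n m : nat) (S : set (circle R * torus2 R)) : Prop :=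
  exists2 g, torus_parametrization n m g & S = torus_graph m g.

Definition all_tori : set (set (circle R * torus2 R)) :=
  [set S | exists n m, [/\ (0 < n)%N, (0 < m)%N & invariant_torus n m S]].

Definition tori (n m : nat) : set (set (circle R * torus2 R)) :=
  [set S | exists k, (0 < k <= n)%N /\ invariant_torus k m S].

End InvariantTori.

(* Main.v *)
Require Import Defs.
From HB Require Import structures.
From mathcomp Require Import all_boot all_order all_algebra.
From mathcomp Require Import finmap ring_quotient complex.
From mathcomp Require Import all_classical all_reals all_analysis.
From mathcomp Require Import ring lra zify.

Set Implicit Arguments.
Unset Strict Implicit.
Unset Printing Implicit Defensive.

Import Order.TTheory GRing.Theory Num.Theory.
Import numFieldTopology.Exports numFieldNormedType.Exports.

Local Open Scope classical_set_scope.
Local Open Scope ring_scope.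

(** Write [H] for a lift of [h] and [deg] for its vector of degrees.  Hyperbolicity
    makes the equation [G (w + alpha) = A (G w) + H w] solvable by a uniformly
    continuous [G : R -> R^2] with [G (w + 1) = G w + L], where
    [L = (I - A)^-1 deg]: in eigencoordinates of [A] it splits into two scalar
    equations whose solutions are geometric series, summed over the past for
    the contracting eigenvalue and over the future for the expanding one
    ([linearization]).  In the coordinates [(w, y) |-> (w mod 1, G w + y)] on
    R x T^2 the map phi becomes [(w, y) |-> (w + alpha, A y)]
    ([iter_skew_product]), and everything reduces to the hyperbolic toral
    automorphism [A].

    Tori.  If [g] parametrizes a phi^n-invariant torus, then [f = g - G mod 1]
    satisfies [f (w + n alpha) = A^n (f w)].  For small [t] the difference
    [f (w + t) - f w] is small uniformly in [w], so its whole two-sided orbit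
    under [A^n] stays near 0; expansivity forces it to vanish, and [f] is a
    constant [p] with [A^n p = p] ([equivariant_constant]).  Hence
    [g = G + p mod 1]; the least positive integer period of such a [g] is the
    order of [L] in T^2, that is [m], so all tori have degree [m]
    ([param_fixed_graph]).
    Two points [p] give the same torus only if they differ by a multiple of
    [L], so up to the bounded factor [m] the tori are counted by the points
    fixed by some [A^k] with [k <= n].  By the Smith normal form [A^k] has
    |det (A^k - I)| fixed points ([torus_kernel]), a number comparable to
    [rho ^ k], where [rho > 1] is the modulus of the expanding eigenvalue
    ([hyperbolic_prod_bounds]); a geometric sum then shows that the number of
    tori is comparable to [rho ^ n] ([tori_count]).

    Entropy.  The maximal cardinality of an (n, e)-separated set is also
    comparable to [rho ^ n].  Below: the points fixed by [A^n] are
    (n, e)-separated for one [e] valid for all [n], again by expansivity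
    ([max_separated_lower]).  Above: [w] and the stable coordinate of [y] known
    up to a constant error, together with the unstable coordinate known up to
    an error of order [rho ^ -n], determine the first [n] iterates up to [e],
    and O([rho ^ n]) cells suffice ([max_separated_upper]).  Both sides of the
    limit are therefore [ln rho]. *)

(** * Uniform continuity of periodic maps *)

Lemma periodic_shift (R : realType) (U : Type) (T : R) (f : R -> U) :
  (forall x, f (x + T) = f x) -> forall (x : R) (k : int), f (x + k%:~R * T) = f x.
Proof.
move=> fT x k; elim: k => [|k IH|k IH]; first by rewrite mul0r addr0.
  by rewrite -addn1 PoszD intrD mulrDl mul1r addrA fT.
rewrite -IH -[in LHS]fT; congr f.
by rewrite -addn1 PoszD opprD intrD mulrDl mulN1r addrA subrK.
Qed.

(** Heine-Cantor: compactness of [[0, T]] gives one modulus for all base points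
    of a fundamental interval, and a translation by a multiple of [T] brings any
    [x] there; [y] may leave the interval, so only [x] is restricted to it. *)
Lemma periodic_unif_continuous (R : realType) (U : pseudoMetricType R) (T : R)
    (f : R -> U) : 0 < T -> (forall x, f (x + T) = f x) -> continuous f ->
  forall e : R, 0 < e -> exists2 d : R, 0 < d &
    forall x y, `|x - y| < d -> ball (f x) e (f y).
Proof.
move=> T0 fT cf e e0.
have /compact_near_coveringP cov := @segment_compact R 0 T.
pose P (d x : R) := forall y, `|x - y| < d -> ball (f x) e (f y).
have covP : \forall d \near (0 : R)^'+, `[0, T] `<=` P d.
  apply: (cov _ _ P _) => x _.
  have /cf/nbhs_ballP[c /= c0 cP] : nbhs (f x) (ball (f x) (e / 2)).
    by apply: nbhsx_ballx; rewrite divr_gt0.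
  exists (ball x (c / 2), [set d : R | d < c / 2]) => /=.
    by split; [apply: nbhsx_ballx | apply: nbhs_right_lt]; rewrite divr_gt0.
  move=> [x' d] /= [xx' dc] y x'y.
  rewrite [e]splitr; apply: (@ball_triangle _ _ (f x)).
    by apply/ball_sym/cP; apply: le_ball xx'; lra.
  apply: cP; rewrite [c]splitr; apply: (ball_triangle xx').
  by rewrite /ball /= (lt_trans x'y).
have [d [d0 dP]] := filter_ex (filterI (nbhs_right_gt 0) covP).
exists d => // x y xy.
pose k := Num.floor (x / T).
have kx : x - k%:~R * T \in `[0, T].
  have := floor_le_tmp (x / T); have := floorD1_gt (x / T).
  rewrite -/k intrD1 ltr_pdivrMr // ler_pdivlMr // in_itv /= mulrDl mul1r => h1 h2.
  by apply/andP; split; lra.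
rewrite -(periodic_shift fT x (- k)) -(periodic_shift fT y (- k)) intrN !mulNr.
by apply: (dP _ kx); rewrite opprD addrACA subrr addr0.
Qed.

(** The radius of constancy doubles by passing through a midpoint. *)
Lemma locally_constant (R : realType) (U : Type) (d : R) (f : R -> U) : 0 < d ->
  (forall x y, `|x - y| < d -> f x = f y) -> forall x y, f x = f y.
Proof.
move=> d0 fd.
suff h (n : nat) x t : `|t| < d * 2 ^+ n -> f x = f (x + t).
  move=> x y; pose n := (Num.truncn (`|y - x| / d)).+1.
  rewrite (h n x (y - x)) ?subrKC // mulrC -ltr_pdivrMr //.
  apply: lt_le_trans (truncnS_gt _) _.
  by rewrite -natrX ler_nat ltnW // ltn_expl.
elim: n x t => [x t|n IH x t tn].
  by rewrite mulr1 => tn; apply: fd; rewrite opprD addrA subrr sub0r normrN.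
have tn2 : `|t / 2| < d * 2 ^+ n.
  by rewrite normrM normfV normr_nat ltr_pdivrMr // -mulrA -exprSr.
by rewrite (IH x (t / 2)) // (IH (x + t / 2) (t / 2)) // -addrA -splitr.
Qed.

(** * Lifts of circle maps and existence of the degree *)

Section CircleLifts.
Context {R : realType}.
Implicit Types (x y : R) (a b : circle R).

(** Two lifts of the same point differ by an integer.  Identities between real
    lifts are obtained this way: reduce them mod 1 and bound both sides. *)
Lemma mod1_small_inj x y : mod1 x = mod1 y -> `|x - y| < 1 -> x = y.
Proof.
move=> /eqP; rewrite mod1_eq => xy lt1; apply/eqP; rewrite -subr_eq0.
by apply: contraTT lt1 => /(norm_intr_ge1 xy); rewrite -leNgt.
Qed.

(** A section of [mod1] that is isometric for [cnorm] and, near 0, additive; it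
    measures small displacements on the circle as real numbers. *)
Definition short_lift a : R := sval (cid2 (cnorm_attained a)).

Lemma short_liftK a : mod1 (short_lift a) = a.
Proof. by rewrite /short_lift; case: cid2. Qed.

Lemma norm_short_lift a : `|short_lift a| = cnorm a.
Proof. by rewrite /short_lift; case: cid2 => /= x _ ->. Qed.

Lemma short_liftD a b : cnorm a + cnorm b < 2^-1 ->
  short_lift (a + b) = short_lift a + short_lift b.
Proof.
move=> ab; apply: mod1_small_inj; first by rewrite raddfD /= !short_liftK.
apply: le_lt_trans (ler_normB _ _) _; rewrite norm_short_lift.
have := cnormD a b; have := ler_normD (short_lift a) (short_lift b).
rewrite !norm_short_lift; lra.
Qed.

Lemma short_liftN a : cnorm a < 2^-1 -> short_lift (- a) = - short_lift a.
Proof.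
move=> a2; apply: mod1_small_inj; first by rewrite raddfN /= !short_liftK.
apply: le_lt_trans (ler_normB _ _) _; rewrite normrN !norm_short_lift cnormN.
lra.
Qed.

Lemma int_primitive (V : zmodType) (c0 : V) (s : int -> V) :
  exists2 c : int -> V, c 0 = c0 & forall k, c (k + 1) = c k + s k.
Proof.
exists (fun k => match k with
    | Posz n => c0 + \sum_(i < n) s i
    | Negz n => c0 - \sum_(i < n.+1) s (Negz i) end).
  by rewrite /= big_ord0 addr0.
case=> n; first by rewrite -PoszD addn1 big_ord_recr addrA.
case: n => [|n].
  by rewrite (_ : Negz 0 + 1 = 0) //= big_ord0 big_ord1 addr0 subrK.
rewrite (_ : Negz n.+1 + 1 = Negz n); last by lia.
by rewrite [in RHS]big_ord_recr /= opprD addrA subrK.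
Qed.

(** Path lifting along the grid of mesh [d / 2]: lift the grid points by adding
    up short lifts of the increments, and each other point relative to the grid
    point on its left.  The exact increment formula carries both the continuity
    and the equivariance of the lift over to its users.  The bound 1/8 lets
    three short lifts add up without leaving the range where [short_lift] is
    additive. *)
Lemma ex_lift (u : R -> circle R) (d : R) : 0 < d ->
    (forall x y, `|x - y| < d -> cnorm (u x - u y) < 8^-1) ->
  exists F : R -> R, (forall x, mod1 (F x) = u x) /\
    forall x y, `|x - y| < d / 2 -> F x - F y = short_lift (u x - u y).
Proof.
move=> d0 ud; pose h := d / 2; have h0 : 0 < h by rewrite divr_gt0.
have hd : h < d by rewrite /h; lra.
have [c0 c0P] := mod1_surj (u 0).
pose s k := short_lift (u ((k + 1)%:~R * h) - u (k%:~R * h)).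
have [c cE cS] := int_primitive c0 s.
have cP k : mod1 (c k) = u (k%:~R * h).
  elim: k => [|k IH|k IH]; first by rewrite cE mul0r.
    by rewrite -addn1 PoszD cS raddfD /= IH short_liftK subrKC.
  have := cS (- k.+1%:Z); rewrite (_ : - k.+1%:Z + 1 = - k%:Z); last by lia.
  move=> /(congr1 mod1); rewrite IH raddfD /= short_liftK.
  rewrite (_ : - k.+1%:Z + 1 = - k%:Z); last by lia.
  set u1 := u _; set u2 := u _ => E.
  by apply: (addIr (u1 - u2)); rewrite -E subrKC.
pose k x := Num.floor (x / h).
pose F x := c (k x) + short_lift (u x - u ((k x)%:~R * h)).
have kP x : (k x)%:~R * h <= x < (k x)%:~R * h + h.
  have := floor_le_tmp (x / h); have := floorD1_gt (x / h).
  rewrite -/(k x) intrD1 ltr_pdivrMr // ler_pdivlMr // mulrDl mul1r => h1 h2.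
  by rewrite h1 h2.
exists F; split=> [x|].
  by rewrite raddfD /= cP short_liftK subrKC.
have key x y : x <= y -> y < x + h -> F y - F x = short_lift (u y - u x).
  move=> xy yx; have [/andP[k1 k2] /andP[l1 l2]] := (kP x, kP y).
  (* [y - x] is less than a mesh, so at most one grid point separates them *)
  have : (k y == k x) || (k y == k x + 1).
    have : (k x <= k y < k x + 2)%R.
      rewrite le_floor ?ler_pM2r ?invr_gt0 //= -(ltr_int R) -(ltr_pM2r h0).
      rewrite intrD mulrDl; lra.
    lia.
  case/orP => /eqP E.
    rewrite /F E opprD addrACA subrr add0r -short_liftN; last first.
      apply: lt_trans (ud _ _ _) _; last by lra.
      by rewrite ger0_norm; lra.
    rewrite -short_liftD; first by rewrite opprB subrKA.
    rewrite cnormN.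
    have := ud x ((k x)%:~R * h); have := ud y ((k x)%:~R * h).
    rewrite E in l1 l2.
    rewrite !ger0_norm; lra.
  have e1 := ud x ((k x)%:~R * h).
  have e2 := ud y ((k y)%:~R * h).
  have e3 := ud ((k y)%:~R * h) ((k x)%:~R * h).
  rewrite E intrD mulrDl mul1r in l1 l2 e2 e3.
  rewrite ger0_norm in e1; last by lra.
  rewrite ger0_norm in e2; last by lra.
  rewrite ger0_norm in e3; last by lra.
  have {}e1 := e1 ltac:(lra).
  have {}e2 := e2 ltac:(lra).
  have {}e3 := e3 ltac:(lra).
  rewrite /F E cS /s intrD mulrDl mul1r.
  set a := u _ - _ in e2 *; set b := u _ - _ in e3 *; set a' := u _ - _ in e1 *.
  rewrite (_ : u y - u x = a + (b - a')); last first.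
    by rewrite /a /b /a' addrA subrKA opprB subrKA.
  rewrite short_liftD; last first.
    have := cnormD b (- a'); rewrite cnormN; lra.
  rewrite short_liftD ?cnormN; last by lra.
  rewrite short_liftN; last by lra.
  ring.
move=> x y xy; case: (leP x y) => le.
  rewrite -[LHS]opprB key //; last by move: xy; rewrite ler0_norm -/h; lra.
  rewrite -short_liftN ?opprB //; apply: lt_trans (ud _ _ _) _; last by lra.
  by rewrite distrC (lt_trans xy).
by rewrite key // ?ltW //; move: xy; rewrite gtr0_norm -/h; lra.
Qed.

(** [F (x + 1) - F x] is locally constant, as [F] has the same increments near
    [x + 1] as near [x]; it is an integer, which is the degree. *)
Lemma has_degree_ex (f : circle R -> circle R) :
  continuous f -> exists d, has_degree f d.
Proof.
move=> cf; pose u x := f (mod1 x).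
have cu : continuous u.
  by move=> x; apply: continuous_comp; [exact: mod1_continuous|exact: cf].
have uT x : u (x + 1) = u x.
  rewrite /u; congr f; apply/eqP; rewrite mod1_eq addrAC subrr add0r.
  exact: (intr_int R 1).
have e8 : 0 < 8^-1 :> R by [].
have [d d0 dP] := periodic_unif_continuous ltr01 uT cu e8.
have [||F [FE Fd]] := @ex_lift u d; first exact: d0.
  by move=> x y xy; have := dP _ _ xy; rewrite cballE /= -cnormN opprB.
have d20 : 0 < d / 2 by rewrite divr_gt0.
have const x : F (x + 1) - F x = F (0 + 1) - F 0.
  apply: (@locally_constant R R (d / 2) (fun x => F (x + 1) - F x) d20) => {}x y xy.
  have xy1 : `|(x + 1) - (y + 1)| < d / 2 by rewrite opprD addrACA subrr addr0.
  have := Fd _ _ xy1; have := Fd _ _ xy; rewrite !uT; lra.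
have : F (0 + 1) - F 0 \is a Num.int.
  by rewrite -mod1_eq !FE uT.
move=> /intrP[k kE]; exists k, F; split=> //; last first.
  by move=> x; rewrite -kE -(const x) subrKC.
move=> x; apply/cvgrPdist_lt => e e0.
have /nbhs_ballP[c /= c0 cP] : \forall y \near x, ball (u x) e (u y).
  by apply: cu; apply: nbhsx_ballx.
apply/nbhs_ballP; exists (Num.min c (d / 2)) => /= [|y].
  by rewrite lt_min c0.
rewrite /ball /= lt_min => /andP[yc yd].
by rewrite Fd // norm_short_lift -cnormN opprB; have := cP _ yc; rewrite cballE.
Qed.
End CircleLifts.

(** * The cohomological equation over a translation *)

Section Cohomological.
Context {R : realType}.

Definition unif_cont (f : R -> R) := forall e, 0 < e ->
  exists2 d, 0 < d & forall x y, `|x - y| < d -> `|f x - f y| < e.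

Lemma unif_cont_lin (a c : R) : unif_cont (fun x => a * x + c).
Proof.
move=> e e0; exists (e / (`|a| + 1)) => [|x y].
  by rewrite divr_gt0 // ltr_wpDl.
rewrite ltr_pdivlMr ?ltr_wpDl // => xy.
rewrite opprD addrACA subrr addr0 -mulrBr normrM.
have := normr_ge0 (x - y); nra.
Qed.

Lemma unif_contD (f g : R -> R) :
  unif_cont f -> unif_cont g -> unif_cont (fun x => f x + g x).
Proof.
move=> uf ug e e0; have e2 : 0 < e / 2 by rewrite divr_gt0.
have [c c0 cP] := uf _ e2; have [d d0 dP] := ug _ e2.
exists (Num.min c d) => [|x y]; first by rewrite lt_min c0.
rewrite lt_min => /andP[/cP h1 /dP h2].
rewrite opprD addrACA (le_lt_trans (ler_normD _ _)) //; lra.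
Qed.

Lemma unif_contZ (a : R) (f : R -> R) :
  unif_cont f -> unif_cont (fun x => a * f x).
Proof.
move=> uf e e0; have a1 : 0 < `|a| + 1 by rewrite ltr_wpDl.
have [d d0 dP] := uf _ (divr_gt0 e0 a1); exists d => // x y /dP.
rewrite ltr_pdivlMr // -mulrBr normrM; have := normr_ge0 (f x - f y); nra.
Qed.

Lemma unif_cont_shift (a : R) (f : R -> R) :
  unif_cont f -> unif_cont (fun x => f (x + a)).
Proof.
move=> uf e e0; have [d d0 dP] := uf _ e0; exists d => // x y xy.
by apply: dP; rewrite opprD addrACA subrr addr0.
Qed.

Lemma unif_cont_continuous (f : R -> R) : unif_cont f -> continuous f.
Proof.
move=> uf x; apply/cvgrPdist_lt => e /uf[d d0 dP].
by apply/nbhs_ballP; exists d => //= y /dP.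
Qed.

(** Subtracting [a x] leaves a periodic function. *)
Lemma equivariant_unif_cont (f : R -> R) (a : R) :
  continuous f -> (forall x, f (x + 1) = f x + a) -> unif_cont f.
Proof.
move=> cf f1; pose g x := f x + (- a) * x.
have gT x : g (x + 1) = g x by rewrite /g f1; ring.
have cg : continuous g.
  move=> x; apply: cvgD; first exact: cf.
  by apply: cvgM; [exact: cvg_cst|exact: cvg_id].
have ug : unif_cont g.
  move=> e e0; have [d d0 dP] := periodic_unif_continuous ltr01 gT cg e0.
  by exists d.
have := unif_contD ug (unif_cont_lin a 0).
rewrite (_ : (fun x => _) = f) //; apply/funext => x.
by rewrite /g; ring.
Qed.

Lemma periodic_bounded (f : R -> R) :
  continuous f -> (forall x, f (x + 1) = f x) -> exists M, forall x, `|f x| <= M.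
Proof.
move=> cf f1.
have cnf : {within `[0, 1], continuous (fun x => `|f x|)}.
  apply: continuous_subspaceT => x.
  by apply: (continuous_comp (cf x)); exact: norm_continuous.
have [c _ cP] := EVT_max (@ler01 R) cnf.
exists `|f c| => x.
rewrite -(periodic_shift f1 x (- Num.floor x)) mulr1; apply: cP.
rewrite in_itv /= intrN.
have := floor_le_tmp x; have := floorD1_gt x; rewrite intrD1; lra.
Qed.

Lemma geometric_sum_le (z : R) n : 0 <= z < 1 -> \sum_(0 <= k < n) z ^+ k <= (1 - z)^-1.
Proof.
move=> /andP[z0 z1]; have z1' : 0 < 1 - z by lra.
rewrite -[leRHS]div1r ler_pdivlMr // mulrC big_mkord -opprB mulNr -subrX1 opprB.
by rewrite gerBl exprn_ge0.
Qed.

(** The solution is the sum over the past,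
    [q x = \sum_k mu^k p (x - (k + 1) b)]. *)
Lemma contracting_cohomology_periodic (mu b : R) (p : R -> R) : `|mu| < 1 ->
    unif_cont p -> (forall x, p (x + 1) = p x) ->
  exists q : R -> R, [/\ unif_cont q, forall x, q (x + 1) = q x &
    forall x, q (x + b) = mu * q x + p x].
Proof.
move=> mu1 up pT.
have [M pM] := periodic_bounded (unif_cont_continuous up) pT.
have mu01 : 0 <= `|mu| < 1 by rewrite normr_ge0.
pose t x : R^nat := fun k => mu ^+ k * p (x - k.+1%:R * b).
have cvt x : cvgn (series (t x)).
  apply: normed_cvg.
  apply: (@series_le_cvg _ _ (geometric M `|mu|)) => [k|k|k|] /=.
  - exact: normr_ge0.
  - by rewrite mulr_ge0 ?exprn_ge0 // (le_trans _ (pM 0)).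
  - by rewrite /t normrM normrX mulrC ler_wpM2r ?exprn_ge0.
  - by apply: is_cvg_geometric_series; rewrite normr_id.
pose q x := limn (series (t x)).
have cq x : series (t x) @ \oo --> q x := cvt x.
exists q; split=> [e e0|x|x].
- have z1 : 0 < 1 - `|mu| by lra.
  have eta0 : 0 < e / 2 * (1 - `|mu|) by rewrite mulr_gt0 ?divr_gt0.
  have [d d0 dP] := up _ eta0; exists d => // x y xy.
  apply: (@le_lt_trans _ _ (e / 2)); last by lra.
  have cD : (`|series (t x) n - series (t y) n|) @[n --> \oo] --> `|q x - q y|.
    by apply: cvg_norm; apply: cvgB.
  apply: (ler_cvg_to cD (cvg_cst (e / 2))); apply: nearW => n.
  rewrite /series /= -sumrB.
  apply: le_trans (ler_norm_sum _ _ _) _.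
  apply: (@le_trans _ _ (\sum_(0 <= k < n) `|mu| ^+ k * (e / 2 * (1 - `|mu|)))).
    apply: ler_sum => k _; rewrite /t -mulrBr normrM normrX.
    rewrite ler_wpM2l ?exprn_ge0 //; apply/ltW/dP.
    by rewrite opprD addrACA subrr addr0.
  rewrite -mulr_suml mulrCA ger_pMr ?divr_gt0 // -ler_pdivlMr // div1r.
  exact: geometric_sum_le.
- congr (limn (series _)); apply/funext => k.
  by rewrite /t -(pT (x - _)) addrAC.
- have c1 : [sequence series (t (x + b)) n.+1]_n @ \oo --> q (x + b).
    by rewrite cvg_shiftS.
  apply: (cvg_unique _ c1) => //.
  have c2 : (mu * series (t x) n + p x) @[n --> \oo] --> mu * q x + p x.
    by apply: cvgD; [apply: cvgM; [exact: cvg_cst|exact: cq]|exact: cvg_cst].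
  apply: cvg_trans c2; apply: near_eq_cvg; apply: nearW => n; apply/esym.
  rewrite /series /= big_nat_recl // addrC.
  congr (_ + _); last by rewrite /t expr0 mul1r mul1r addrK.
  rewrite mulr_sumr; apply: eq_bigr => k _; rewrite /t exprS mulrA.
  by congr (_ * p _); rewrite -[k.+2]addn1 natrD; ring.
Qed.

(** An affine function solves the equation whose right-hand side is [a x], which
    reduces the equivariant case to the periodic one. *)
Lemma contracting_cohomology (mu b a : R) (p : R -> R) : `|mu| < 1 ->
    unif_cont p -> (forall x, p (x + 1) = p x + a) ->
  exists q : R -> R, [/\ unif_cont q, forall x, q (x + 1) = q x + a / (1 - mu) &
    forall x, q (x + b) = mu * q x + p x].
Proof.
move=> mu1 up p1; have mu_neq : 1 - mu != 0.
  by rewrite subr_eq0 eq_sym; apply: contraTneq mu1 => ->; rewrite normr1 ltxx.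
have [||q0 [uq q1 qb]] := @contracting_cohomology_periodic mu b
    (fun x => p x + (- a * x + 0)) mu1.
- exact: unif_contD up (unif_cont_lin _ _).
- by move=> x; rewrite p1; ring.
(* [x |-> a / (1 - mu) * x + c] solves the equation for [x |-> a * x] *)
pose c := - (a / (1 - mu) * b) / (1 - mu).
exists (fun x => q0 x + (a / (1 - mu) * x + c)); split=> [|x|x].
- exact: unif_contD uq (unif_cont_lin _ _).
- by rewrite q1; ring.
- by rewrite qb /c; field.
Qed.

(** An expanding [mu] is contracting for the translation by [- b]. *)
Lemma hyperbolic_cohomology (mu b a : R) (p : R -> R) : mu != 0 -> `|mu| != 1 ->
    unif_cont p -> (forall x, p (x + 1) = p x + a) ->
  exists q : R -> R, [/\ unif_cont q, exists c, forall x, q (x + 1) = q x + c &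
    forall x, q (x + b) = mu * q x + p x].
Proof.
move=> mu0; rewrite neq_lt => /orP[mu1|mu1] up p1.
  have [q [uq q1 qb]] := contracting_cohomology b mu1 up p1.
  by exists q; split=> //; exists (a / (1 - mu)).
have mu1' : `|mu^-1| < 1 by rewrite normfV invf_lt1 // (lt_trans ltr01).
have [||q [uq q1 qb]] := @contracting_cohomology mu^-1 (- b) (- mu^-1 * a)
   (fun x => - mu^-1 * p (x + - b)) mu1'.
- exact/unif_contZ/unif_cont_shift.
- by move=> x; rewrite addrAC p1 mulrDr.
exists q; split=> //; first by exists (- mu^-1 * a / (1 - mu^-1)).
move=> x; have := qb (x + b); rewrite !addrK => ->.
by rewrite mulrDr !mulrA mulrN mulfV // mul1r mulN1r subrK.
Qed.
End Cohomological.

(** * Hyperbolic matrices in GL(2,Z) *)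

Lemma det_mx22 (K : comPzRingType) (M : 'M[K]_2) :
  \det M = M 0 0 * M 1 1 - M 0 1 * M 1 0.
Proof.
rewrite (expand_det_row _ ord0) !big_ord_recl big_ord0 addr0 /cofactor !det_mx11.
by rewrite !mxE /= expr0 expr1 !mul1r mulN1r mulrN; congr (_ * M _ _ - M _ _ * M _ _);
   apply/val_inj.
Qed.

Lemma eigenvalue_mx22 (F : fieldType) (M : 'M[F]_2) (l : F) :
  eigenvalue M l = (l ^+ 2 - (M 0 0 + M 1 1) * l + \det M == 0).
Proof.
have -> : l ^+ 2 - (M 0 0 + M 1 1) * l + \det M = \det (M - l%:M).
  by rewrite !det_mx22 !mxE /= !mulr1n !mulr0n; ring.
apply/eigenvalueP/det0P => [[v vM v0]|[v v0 vM]]; exists v => //.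
  by rewrite mulmxBr vM mul_mx_scalar subrr.
by apply/eqP; rewrite -subr_eq0 -mul_mx_scalar -mulmxBr vM.
Qed.

Section Hyperbolic.
Context {R : realType}.
Local Notation intmx A := (map_mx intr A : 'M[R]_2).

Lemma hyperbolic_root (A : 'M[int]_2) (l : R[i]) : @hyperbolic R A ->
  l ^+ 2 - (A 0 0 + A 1 1)%:~R * l + (\det A)%:~R = 0 -> `|l| != 1.
Proof.
move=> hA lA; apply: hA; rewrite eigenvalue_mx22 !mxE -intrD det_map_mx.
exact/eqP.
Qed.

Lemma hyperbolic_real_root (A : 'M[int]_2) (l : R) : @hyperbolic R A ->
  l ^+ 2 - (A 0 0 + A 1 1)%:~R * l + (\det A)%:~R = 0 -> `|l| != 1.
Proof.
move=> /hyperbolic_root hA lA; have := hA l%:C%C.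
rewrite -!(rmorph_int (real_complex R)) -!rmorphXn -!rmorphM -rmorphB -rmorphD /= lA.
move=> /(_ erefl); rewrite normc_def /= expr0n addr0 sqrtr_sqr.
by apply: contraNneq => ->.
Qed.

(** The determinant being 1 or -1, non-real or equal eigenvalues would have
    modulus 1.  So there are two distinct real ones, one of modulus greater than
    1, put first in [d]; the rows of [W] are left eigenvectors. *)
Lemma hyperbolic_diag (A : 'M[int]_2) : A \in unitmx -> @hyperbolic R A ->
  exists W : 'M[R]_2, exists d : 'rV[R]_2,
  [/\ W \in unitmx, W *m intmx A = diag_mx d *m W,
      1 < `|d 0 0| & `|d 0 0 * d 0 1| = 1].
Proof.
move=> A_unit hA; have hAr := hyperbolic_real_root hA.
set t := (A 0 0 + A 1 1)%:~R in hAr; set D := (\det A)%:~R in hAr.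
have normDz : `|\det A|%N = 1%N.
  have := A_unit; rewrite unitmxE => /mulrV/(congr1 absz).
  by rewrite abszM => /eqP; rewrite muln_eq1 => /andP[/eqP].
have normD : `|D| = 1 by rewrite /D -intr_norm -abszE normDz.
(* otherwise the integer [A 0 0], a divisor of the determinant, is an
   eigenvalue; this makes the rows [(A 1 0, l - A 0 0)] eigenvectors that are
   independent for distinct [l] *)
have c0 : A 1 0 != 0.
  apply/eqP => c0; have := hAr (A 0 0)%:~R; rewrite /t /D det_mx22 c0.
  rewrite mulr0 subr0 rmorphM rmorphD /= => h.
  have : absz (A 0 0) = 1%N.
    move: normDz; rewrite det_mx22 c0 mulr0 subr0 abszM => /eqP.
    by rewrite muln_eq1 => /andP[/eqP].
  move=> /(congr1 (fun n => n%:Z%:~R : R)); rewrite abszE intr_norm.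
  by apply/eqP/h; ring.
have main lam mu : lam + mu = t -> lam * mu = D -> lam != mu -> 1 < `|lam| ->
   exists W : 'M[R]_2, exists d : 'rV[R]_2,
  [/\ W \in unitmx, W *m intmx A = diag_mx d *m W,
      1 < `|d 0 0| & `|d 0 0 * d 0 1| = 1].
  move=> lamDmu lamMmu lam_mu lam1.
  pose d : 'rV[R]_2 := \row_i (if i == 0 then lam else mu).
  exists (\matrix_(i, j) (if j == 0 then (A 1 0)%:~R else d 0 i - (A 0 0)%:~R)), d.
  split.
  - rewrite unitmxE unitfE det_mx22 !mxE /=.
    rewrite [X in X != 0](_ : _ = (A 1 0)%:~R * (mu - lam)); last by ring.
    by rewrite mulf_neq0 // ?intr_eq0 // subr_eq0 eq_sym.
  - have dP i : d 0 i ^+ 2 = t * d 0 i - D.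
      by rewrite mxE -lamDmu -lamMmu; case: ifP => _; ring.
    apply/matrixP => i j; rewrite mul_diag_mx !mxE !big_ord_recl big_ord0 !mxE /=.
    have := dP i; rewrite /t /D det_mx22 rmorphB !rmorphM rmorphD /= mxE => e.
    have j01 : j = 0 \/ j = 1 by case: j => -[|[|//]] /= ?; [left|right]; apply/val_inj.
    case: j01 => -> /=.
      rewrite (_ : lift _ _ = 1); last exact/val_inj.
      ring.
    rewrite (_ : lift _ _ = 1); last exact/val_inj.
    move: e; case: ifP => _ e; rewrite ?mulrBr -?expr2 e; ring.
  - by rewrite mxE.
  - by rewrite !mxE /= lamMmu.
pose Delta := t ^+ 2 - 4 * D.
have [D0|D0] := leP Delta 0.
  pose s := Num.sqrt (- Delta).
  have s2 : s ^+ 2 = - Delta by rewrite sqr_sqrtr // oppr_ge0.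
  have s2' : s ^+ 2 = 4 * D - t ^+ 2 by rewrite s2 /Delta; ring.
  have D1 : D = 1.
    by rewrite -normD ger0_norm //; have := sqr_ge0 t; have := sqr_ge0 s; lra.
  (* the complex root with nonnegative imaginary part has modulus 1 *)
  have := @hyperbolic_root A (t / 2 +i* (s / 2))%C hA.
  have e : (t / 2) ^+ 2 + (s / 2) ^+ 2 = 1.
    by rewrite !expr_div_n s2' D1; field.
  rewrite normc_def /= e sqrtr1 eqxx => h; exfalso; suff: false by []; apply: h.
  rewrite -!(rmorph_int (real_complex R)) -/t -/D.
  apply/eqP; rewrite eq_complex; simpc => /=.
  by apply/andP; split; apply/eqP; [rewrite D1 -[X in _ + X]e|]; field.
pose s := Num.sqrt Delta; have s2 : s ^+ 2 = Delta by rewrite sqr_sqrtr // ltW.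
have s0 : 0 < s by rewrite sqrtr_gt0.
pose lam := (t + s) / 2; pose mu := (t - s) / 2.
have lamDmu : lam + mu = t by rewrite /lam /mu; field.
have lamMmu : lam * mu = D.
  rewrite (_ : lam * mu = (t ^+ 2 - s ^+ 2) / 4); last by rewrite /lam /mu; field.
  by rewrite s2 /Delta; field.
have lam_mu : lam != mu.
  by rewrite -subr_eq0 (_ : lam - mu = s) ?gt_eqF // /lam /mu; field.
have : `|lam| != 1 by apply: hAr; rewrite -lamDmu -lamMmu; ring.
rewrite neq_lt => /orP[lam1|lam1]; last exact: (main lam mu).
apply: (main mu lam); rewrite 1?addrC 1?mulrC 1?eq_sym //.
have := normD; rewrite -lamMmu normrM; have := normr_ge0 lam; have := normr_ge0 mu; nra.
Qed.

Section Diagonalized.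
Variables (B W : 'M[R]_2) (d : 'rV[R]_2).
Hypotheses (Wu : W \in unitmx) (WB : W *m B = diag_mx d *m W).

Lemma diag_pow k : W *m B ^+ k = diag_mx (\row_i d 0 i ^+ k) *m W.
Proof.
elim: k => [|k IH].
  rewrite expr0 mulmx1; apply/matrixP => i j.
  by rewrite mul_diag_mx !mxE expr0 mul1r.
rewrite exprS -mulmxE mulmxA WB -mulmxA IH; apply/matrixP => i j.
by rewrite !mul_diag_mx !mxE exprS mulrA.
Qed.

Lemma diag_coord k (X : 'cV[R]_2) i :
  (W *m (B ^+ k *m X)) i 0 = d 0 i ^+ k * (W *m X) i 0.
Proof. by rewrite mulmxA diag_pow -mulmxA mul_diag_mx !mxE. Qed.

Lemma det_pow_sub1 k : \det (B ^+ k - 1) = (d 0 0 ^+ k - 1) * (d 0 1 ^+ k - 1).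
Proof.
pose e : 'rV[R]_2 := \row_i (d 0 i ^+ k - 1).
have WBk : W *m (B ^+ k - 1) = diag_mx e *m W.
  rewrite mulmxBr diag_pow mulmx1; apply/matrixP => i j.
  by rewrite !mul_diag_mx !mxE mulrBl mul1r.
have : \det W * \det (B ^+ k - 1) = \det W * (e 0 0 * e 0 1).
  rewrite -det_mulmx WBk det_mulmx det_diag mulrC; congr (_ * _).
  by rewrite !big_ord_recl big_ord0 mulr1; congr (_ * e _ _); apply/val_inj.
have W0 : \det W != 0 by rewrite -unitfE -unitmxE.
by move/(mulfI W0) ->; rewrite !mxE.
Qed.
End Diagonalized.

(** With [l], [m] the eigenvalues of [A], the quantity bounded here is
    |det (A^k - I)|, the number of points of T^2 fixed by [A^k]. *)
Lemma hyperbolic_prod_bounds (l m : R) k : 1 < `|l| -> `|l * m| = 1 -> (0 < k)%N ->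
  (1 - `|l|^-1) ^+ 2 * `|l| ^+ k <= `|(l ^+ k - 1) * (m ^+ k - 1)| <= 4 * `|l| ^+ k.
Proof.
move=> l1 lm k0; rewrite normrM in lm; set r := `|l| in l1 lm *.
have r0 : 0 < r by apply: lt_trans l1.
have mE : `|m| = r^-1 by apply: (mulfI (lt0r_neq0 r0)); rewrite lm mulfV ?gt_eqF.
have r1 : r^-1 < 1 by rewrite invf_lt1.
have ri0 : 0 < r^-1 by rewrite invr_gt0.
have rk : r <= r ^+ k by rewrite ler_eXnr ?ltW.
have rik : r^-1 ^+ k <= r^-1 by rewrite ler_iXnr ?ltW.
have rik0 : 0 < r^-1 ^+ k by rewrite exprn_gt0.
have rrk : r^-1 * r ^+ k >= 1 by rewrite mulrC ler_pdivlMr // mul1r.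
have hl1 := ler_normB (l ^+ k) 1; have hl2 := lerB_dist (l ^+ k) 1.
have hm1 := ler_normB (m ^+ k) 1; have hm2 := lerB_dist 1 (m ^+ k).
rewrite distrC in hm2; rewrite !normrX normr1 ?mE -/r in hl1 hl2 hm1 hm2.
rewrite normrM; set u := `|l ^+ k - 1| in hl1 hl2 *.
set v := `|m ^+ k - 1| in hm1 hm2 *; set x := r ^+ k in rk rrk hl1 hl2 *.
set y := r^-1 ^+ k in rik rik0 hm1 hm2; set z := r^-1 in r1 ri0 rrk rik *.
have u0 : 0 <= u := normr_ge0 _.
have ux : (1 - z) * x <= u by lra.
have vx : (1 - z) <= v by lra.
apply/andP; split.
  rewrite expr2 -mulrA [leRHS]mulrC; apply: ler_pM => //; first by lra.
  by apply: mulr_ge0; lra.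
by rewrite (_ : 4 * x = (2 * x) * 2); [apply: ler_pM; lra|ring].
Qed.
End Hyperbolic.

(** * Toral endomorphisms and the size of their kernels *)

Section Torus.
Context {R : realType}.
Implicit Types (A B : 'M[int]_2) (X Y : 'cV[R]_2) (x y : torus2 R).
Local Notation intmx A := (map_mx intr A : 'M[R]_2).

Definition mod1v X : torus2 R := map_mx mod1 X.

Lemma mod1v_is_zmod_morphism : zmod_morphism mod1v.
Proof. by move=> X Y; rewrite /mod1v map_mxB. Qed.

HB.instance Definition _ := GRing.isZmodMorphism.Build _ _ mod1v mod1v_is_zmod_morphism.

Lemma mod1v_surj x : exists X, mod1v X = x.
Proof.
have [X0 h0] := mod1_surj (x 0 0); have [X1 h1] := mod1_surj (x 1 0).
exists (\col_i (if i == 0 then X0 else X1)); apply/matrixP => i j.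
rewrite (ord1 j) !mxE; case: i => -[|[|//]] //= ?; rewrite ?h0 ?h1.
  by congr (x _ _); apply/val_inj.
by congr (x _ _); apply/val_inj.
Qed.

Lemma mod1v_eq0 X : (mod1v X == 0) = (X \is a mxOver Num.int).
Proof.
apply/eqP/mxOverP => [X0 i j|X0].
  have /matrixP/(_ i j) := X0; rewrite !mxE -(raddf0 mod1) => /eqP.
  by rewrite mod1_eq subr0.
apply/matrixP => i j; rewrite !mxE -(raddf0 mod1); apply/eqP.
by rewrite mod1_eq subr0.
Qed.

Lemma torus_action_mod1v A X : torus_action A (mod1v X) = mod1v (intmx A *m X).
Proof.
apply/matrixP => i j; rewrite (ord1 j) !mxE raddf_sum; apply: eq_bigr => k _.
by rewrite !mxE -raddfMz /= mulrzl.
Qed.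

Lemma torus_action_is_zmod_morphism A : zmod_morphism (@torus_action R A).
Proof.
move=> x y; have [[X <-] [Y <-]] := (mod1v_surj x, mod1v_surj y).
by rewrite -raddfB !torus_action_mod1v mulmxBr raddfB.
Qed.

HB.instance Definition _ A :=
  GRing.isZmodMorphism.Build _ _ (@torus_action R A) (torus_action_is_zmod_morphism A).

Lemma torus_actionM A B x : torus_action (A *m B) x = torus_action A (torus_action B x).
Proof.
by have [X <-] := mod1v_surj x; rewrite !torus_action_mod1v map_mxM mulmxA.
Qed.

Lemma torus_action1 x : torus_action 1%:M x = x.
Proof.
by have [X <-] := mod1v_surj x; rewrite torus_action_mod1v map_mx1 mul1mx.
Qed.

Lemma torus_actionB A B x :
  torus_action (A - B) x = torus_action A x - torus_action B x.
Proof.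
have [X <-] := mod1v_surj x.
by rewrite !torus_action_mod1v map_mxB mulmxBl raddfB.
Qed.

Lemma torus_action_exprS A n x :
  torus_action (A ^+ n.+1) x = torus_action A (torus_action (A ^+ n) x).
Proof. by rewrite exprS -torus_actionM. Qed.

Lemma torus_action_inj A : A \in unitmx -> injective (@torus_action R A).
Proof.
by move=> Au; apply: (can_inj (g := torus_action (invmx A))) => x;
  rewrite -torus_actionM mulVmx // torus_action1.
Qed.

Lemma circle_torsionP (d : int) (a : circle R) : d != 0 ->
  a *~ d = 0 <-> exists i : 'I_`|d|%N, a = mod1 (i%:R / `|d|%N%:R).
Proof.
move=> d0; have [X <-] := mod1_surj a; set n := `|d|%N.
have n0z : (n : int) != 0 by rewrite /n; lia.
have n0 : (n%:R : R) != 0 by rewrite pnatr_eq0 absz_eq0.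
have E : (mod1 X *~ d == 0) = (X * n%:R \is a Num.int).
  rewrite -raddfMz -(raddf0 mod1) mod1_eq subr0 /= -mulrzr /n.
  by case: (intP d) => [|k|k] //; rewrite intrN mulrN rpredN.
split=> [/eqP|[i iE]]; last first.
  apply/eqP; rewrite iE -raddfMz -(raddf0 mod1) mod1_eq subr0 /= -mulrzr.
  have -> : (d%:~R : R) = n%:R * (Num.sg d)%:~R.
    by rewrite {1}[d]numEsg intrM mulrC -abszE.
  by rewrite mulrA mulfVK // rpredM ?intr_int // natr_int.
rewrite E => /intrP[k kE].
have i_lt : (`|(k %% n)%Z|%N < n)%N.
  by have := ltz_mod k n0z; have := modz_ge0 k n0z; lia.
exists (Ordinal i_lt); apply/eqP; rewrite mod1_eq /=.
have -> : X - `|(k %% n)%Z|%N%:R / n%:R = (k %/ n)%Z%:~R; last exact: intr_int.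
apply: (mulIf n0); rewrite mulrBl kE mulfVK //.
rewrite {1}(divz_eq k n) intrD intrM.
have -> : (`|(k %% n)%Z|%N%:R : R) = (k %% n)%Z%:~R.
  by rewrite -[LHS]/((`|(k %% n)%Z|%N : int)%:~R) gez0_abs // modz_ge0.
by rewrite addrK.
Qed.

Lemma circle_torsion_inj (n : nat) (i j : 'I_n) :
  mod1 (i%:R / n%:R) = mod1 (j%:R / n%:R) :> circle R -> i = j.
Proof.
case: n i j => [[]//|n] i j /mod1_small_inj ij; apply/val_inj.
have n0 : 0 < n.+1%:R :> R by [].
have : i%:R / n.+1%:R = j%:R / n.+1%:R :> R.
  apply: ij; rewrite -mulrBl normrM normfV (ger0_norm (ltW n0)).
  rewrite ltr_pdivrMr // mul1r ltr_norml.
  have := ltn_ord i; have := ltn_ord j; rewrite -!(ltr_nat R).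
  have : 0 <= i%:R :> R by []. have : 0 <= j%:R :> R by []. lra.
by move/(mulIf (invr_neq0 (lt0r_neq0 n0)))/eqP; rewrite eqr_nat => /eqP.
Qed.

(** By the Smith normal form [B = P D Q] with [P], [Q] invertible and [D]
    diagonal with entries [a], [b]: [Q] maps the kernel of [B] onto that of [D],
    a product of cyclic groups of orders |a| and |b|. *)
Lemma torus_kernel (B : 'M[int]_2) : \det B != 0 ->
  exists2 K : {fset torus2 R}, #|` K| = `|\det B|%N &
    forall x, (x \in K) = (torus_action B x == 0).
Proof.
have [P Pu [Q Qu [d _ ->]]] := int_Smith_normal_form B.
set D := \matrix_(i, j) _; rewrite !det_mulmx => detB.
have unit_det (M : 'M[int]_2) : M \in unitmx -> `|\det M|%N = 1%N.
  rewrite unitmxE => /mulrV/(congr1 absz).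
  by rewrite abszM => /eqP; rewrite muln_eq1 => /andP[/eqP].
pose a := d`_0; pose b := d`_1.
have detD : \det D = a * b.
  by rewrite det_mx22 !mxE /= mulr1n mulr1n mulr0n mulr0n mul0r subr0.
have D0 : \det D != 0 by apply: contraNneq detB => ->; rewrite mulr0 mul0r.
move: D0; rewrite detD mulf_eq0 negb_or => /andP[a0 b0].
pose pt (p : 'I_`|a|%N * 'I_`|b|%N) : torus2 R :=
  torus_action (invmx Q) (\col_i (if i == 0 then mod1 (p.1%:R / `|a|%N%:R)
    else mod1 (p.2%:R / `|b|%N%:R))).
have ptI : injective pt.
  have Qi : invmx Q \in unitmx by rewrite unitmx_inv.
  move=> p q /(torus_action_inj Qi)/matrixP e.
  have := e 0 0; have := e 1 0; rewrite !mxE /=.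
  by case: p q {e} => [i j] [i' j'] /= /circle_torsion_inj -> /circle_torsion_inj ->.
exists [fset pt p | p in {: 'I_`|a|%N * 'I_`|b|%N}]%fset => [|x].
  rewrite card_imfset //= -cardE card_prod !card_ord !abszM.
  by rewrite !unit_det // mul1n muln1.
rewrite !torus_actionM; apply/imfsetP/eqP => [[p _ ->]|].
  rewrite /pt -[torus_action Q _]torus_actionM mulmxV // torus_action1.
  rewrite [X in torus_action P X](_ : _ = 0) ?raddf0 //.
  apply/matrixP => i z; rewrite (ord1 z) {z} !mxE !big_ord_recl big_ord0 !mxE /=.
  case: i => -[|[|//]] ?; rewrite /= ?mulr1n ?mulr0n mulr0z.
    by rewrite !addr0; apply/(circle_torsionP _ a0); exists p.1.
  by rewrite add0r addr0; apply/(circle_torsionP _ b0); exists p.2.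
rewrite -[0](raddf0 (torus_action P)) => /(torus_action_inj Pu) /matrixP e.
have [y yE] : exists y, y = torus_action Q x by exists (torus_action Q x).
rewrite -yE in e.
have /(circle_torsionP _ a0)[i iE] : y 0 0 *~ a = 0.
  have := e 0 0; rewrite !mxE !big_ord_recl big_ord0 !mxE /= mulr1n mulr0n mulr0z.
  by rewrite !addr0.
have /(circle_torsionP _ b0)[j jE] : y 1 0 *~ b = 0.
  have := e 1 0; rewrite !mxE !big_ord_recl big_ord0 !mxE /= mulr1n mulr0n mulr0z.
  by rewrite addr0 add0r (_ : lift _ _ = 1) //; apply/val_inj.
exists (i, j) => //=; apply: (torus_action_inj Qu).
rewrite /pt -[RHS]torus_actionM mulmxV // torus_action1 -yE.
apply/matrixP => k z; rewrite (ord1 z) {z} mxE.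
by case: k => -[|[|//]] ?; rewrite -?iE -?jE /=; congr (y _ _); apply/val_inj.
Qed.
End Torus.

(** * Linearization of the skew product *)

Section Linearization.
Context {R : realType}.
Implicit Types (A : 'M[int]_2) (h : circle R -> torus2 R).
Local Notation intmx A := (map_mx intr A : 'M[R]_2).

Lemma ord2P (i : 'I_2) : i = 0 \/ i = 1.
Proof. by case: i => -[|[|//]] ?; [left|right]; apply/val_inj. Qed.

Lemma component_continuous h i : continuous h -> continuous (component h i).
Proof.
move=> ch w U /nbhs_ballP[e /= e0 eU].
have hw : \forall w' \near w, ball (h w) e (h w').
  by apply: ch; exact: nbhsx_ballx.
by apply: (filterS _ hw) => w' [_ /(_ i 0)] /eU.
Qed.

Lemma degreeP (f : circle R -> circle R) : continuous f -> has_degree f (degree f).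
Proof. by move=> /has_degree_ex[d dP]; exact: (xgetPex 0 (ex_intro _ d dP)). Qed.

(** [G] is a continuous invariant section of a lift of the skew product to
    R x R^2.  It is found one eigencoordinate at a time, and its drift [L] is
    then forced by comparing the two ways to expand [G (w + 1 + alpha)], which
    gives [L = A L + deg]. *)
Lemma linearization (alpha : R) A h :
    A \in unitmx -> @hyperbolic R A -> continuous h ->
  exists G : R -> 'cV[R]_2,
  [/\ forall i, unif_cont (fun w => G w i 0),
      forall w, G (w + 1) = G w + degree_vector A h &
      forall w, h (mod1 w) = mod1v (G (w + alpha) - intmx A *m G w)].
Proof.
move=> Au hA ch; have [W [d [Wu WA d0 d01]]] := hyperbolic_diag Au hA.
set B := intmx A in WA *.
have dP i : d 0 i != 0 /\ `|d 0 i| != 1.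
  have d1n : `|d 0 1| < 1.
    rewrite normrM in d01; have := normr_ge0 (d 0 1); nra.
  case: (ord2P i) => ->; split.
  - by rewrite -normr_gt0 (lt_trans ltr01).
  - by rewrite gt_eqF.
  - by apply: contra_eq_neq d01 => ->; rewrite mulr0 normr0 eq_sym oner_neq0.
  - by rewrite lt_eqF.
have dgP i : has_degree (component h i) (degree (component h i)).
  by apply: degreeP; exact: component_continuous.
have /choice[F FP] := dgP.
set deg : 'cV[R]_2 := \col_i (degree (component h i))%:~R.
pose H w : 'cV[R]_2 := \col_i F i w.
have H1 w : H (w + 1) = H w + deg.
  by apply/matrixP => i j; rewrite !mxE; have [_ _ ->] := FP i.
pose p i w := (W *m H w) i 0.
have up i : unif_cont (p i).
  have -> : p i = (fun w => W i 0 * F 0 w + W i 1 * F 1 w).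
    apply/funext => w; rewrite /p !mxE !big_ord_recl big_ord0 !mxE addr0.
    by congr (_ * F _ _ + W _ _ * F _ _); apply/val_inj.
  have uF j : unif_cont (F j).
    by have [cF _ F1] := FP j; exact: equivariant_unif_cont cF F1.
  by apply: unif_contD; apply: unif_contZ.
have p1 i w : p i (w + 1) = p i w + (W *m deg) i 0.
  by rewrite /p H1 mulmxDr mxE.
have qex i := hyperbolic_cohomology alpha (dP i).1 (dP i).2 (up i) (p1 i).
have /choice[q qP] := qex.
have cex i : exists c, forall x, q i (x + 1) = q i x + c by case: (qP i).
have /choice[c cP] := cex.
pose V := invmx W; pose Q w : 'cV[R]_2 := \col_i q i w.
have Q_alpha w : Q (w + alpha) = diag_mx d *m Q w + W *m H w.
  apply/matrixP => i j; rewrite (ord1 j) mul_diag_mx !mxE.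
  by have [_ _ ->] := qP i; rewrite /p !mxE.
have BV : B *m V = V *m diag_mx d.
  by rewrite /V -[B](mulKmx Wu) WA !mulmxA mulmxK.
pose G w := V *m Q w.
have G_alpha w : G (w + alpha) = B *m G w + H w.
  by rewrite /G Q_alpha mulmxDr /V mulKmx // !mulmxA BV.
pose L := V *m (\col_i c i).
have G1 w : G (w + 1) = G w + L.
  rewrite /G -mulmxDr; congr (_ *m _); apply/matrixP => i j.
  by rewrite !mxE cP.
have LE : L = degree_vector A h.
  have e : (1%:M - B) *m L = deg.
    have := G_alpha (0 + 1); rewrite addrAC G1 G_alpha H1 G1 mulmxDr.
    rewrite [RHS]addrACA => /addrI e.
    by rewrite mulmxBl mul1mx {1}e addrAC subrr add0r.
  rewrite /degree_vector -/deg -e mulKmx //.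
  rewrite -opprB -scaleN1r unitmxZ ?unitrN1 // unitmxE unitfE.
  have := det_pow_sub1 Wu WA 1; rewrite expr1 => ->.
  have neq1 i : d 0 i ^+ 1 - 1 != 0.
    rewrite expr1 subr_eq0; have [_] := dP i; apply: contraNneq => ->.
    by rewrite normr1.
  by rewrite mulf_neq0.
exists G; split=> [i|w|w].
- have -> : (fun w => G w i 0) = (fun w => V i 0 * q 0 w + V i 1 * q 1 w).
    apply/funext => w; rewrite /G !mxE !big_ord_recl big_ord0 !mxE addr0.
    by congr (_ * q _ _ + V _ _ * q _ _); apply/val_inj.
  by apply: unif_contD; apply: unif_contZ; [case: (qP 0)|case: (qP 1)].
- by rewrite G1 LE.
- rewrite G_alpha addrAC subrr add0r; apply/matrixP => i j; rewrite (ord1 j) !mxE.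
  by have [_ <- _] := FP i.
Qed.
End Linearization.

(** * Expansivity *)

Section Expansivity.
Context {R : realType}.
Implicit Types (A B : 'M[int]_2) (X Y : 'cV[R]_2) (x y q : torus2 R).
Local Notation intmx A := (map_mx intr A : 'M[R]_2).

Lemma intmxX A n : intmx (A ^+ n) = intmx A ^+ n.
Proof.
elim: n => [|n IH]; first by rewrite !expr0 map_mx1.
by rewrite !exprS -!mulmxE map_mxM /= IH.
Qed.

Definition torus_small (e : R) q := forall i, cnorm (q i 0) < e.

Definition torus_lift q : 'cV[R]_2 := \col_i short_lift (q i 0).

Lemma torus_liftK q : mod1v (torus_lift q) = q.
Proof.
by apply/matrixP => i j; rewrite (ord1 j) !mxE short_liftK.
Qed.

Lemma torus_lift_eq0 q : torus_lift q = 0 -> q = 0.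
Proof. by rewrite -{2}[q]torus_liftK => ->; rewrite raddf0. Qed.

Lemma mulmx_bound (M : 'M[R]_2) (X : 'cV[R]_2) (e : R) :
    (forall i, `|X i 0| <= e) ->
  forall i, `|(M *m X) i 0| <= (\sum_k \sum_j `|M k j|) * e.
Proof.
move=> Xe i; have e0 : 0 <= e := le_trans (normr_ge0 _) (Xe 0).
rewrite mxE (le_trans (ler_norm_sum _ _ _)) //.
apply: (@le_trans _ _ (\sum_j `|M i j| * e)).
  by apply: ler_sum => j _; rewrite normrM ler_wpM2l.
rewrite -mulr_suml ler_wpM2r // [leRHS](bigD1 i) //= lerDl.
by apply: sumr_ge0 => k _; apply: sumr_ge0.
Qed.

(** Both sides lift [B q], and both are small. *)
Lemma torus_lift_equivariant B : exists2 e : R, 0 < e & forall q,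
  torus_small e q -> torus_small e (torus_action B q) ->
  torus_lift (torus_action B q) = intmx B *m torus_lift q.
Proof.
pose S : R := \sum_k \sum_j `|intmx B k j|.
have S0 : 0 <= S by apply: sumr_ge0 => k _; apply: sumr_ge0.
have S1 : 0 < S + 1 by lra.
exists (S + 1)^-1 => [|q qs Bqs]; first by rewrite invr_gt0.
apply/matrixP => i j; rewrite (ord1 j) {j}; apply: mod1_small_inj.
  have /matrixP/(_ i 0) : mod1v (torus_lift (torus_action B q)) =
      mod1v (intmx B *m torus_lift q).
    by rewrite -torus_action_mod1v !torus_liftK.
  by rewrite mxE => ->; rewrite mxE.
apply: le_lt_trans (ler_normB _ _) _.
have h1 : `|(intmx B *m torus_lift q) i 0| <= S * (S + 1)^-1.
  by apply: mulmx_bound => k; rewrite mxE norm_short_lift ltW.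
have h2 : `|torus_lift (torus_action B q) i 0| < (S + 1)^-1.
  by rewrite mxE norm_short_lift.
have h3 : S * (S + 1)^-1 + (S + 1)^-1 = 1.
  by rewrite -[X in _ + X]mul1r -mulrDl mulfV ?gt_eqF.
lra.
Qed.

Lemma geometric_bounded_eq0 (c r M : R) : 1 < r ->
  (forall k : nat, `|c| * r ^+ k <= M) -> c = 0.
Proof.
move=> r1 cM; have r0 : 0 < r by apply: lt_trans r1.
have cvg0 : geometric M r^-1 @ \oo --> (0 : R).
  by apply: cvg_geometric; rewrite normfV gtr0_norm // invf_lt1.
apply/eqP; rewrite -normr_le0; apply: (ler_cvg_to (cvg_cst `|c|) cvg0).
by apply: nearW => k; rewrite /= exprVn ler_pdivlMr ?exprn_gt0.
Qed.

Section Hyp.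
Variables (A : 'M[int]_2) (W : 'M[R]_2) (d : 'rV[R]_2).
Hypotheses (Wu : W \in unitmx) (WA : W *m intmx A = diag_mx d *m W).
Hypotheses (d0 : 1 < `|d 0 0|) (d01 : `|d 0 0 * d 0 1| = 1).

Lemma det_pow_sub1_neq0 n : (0 < n)%N -> \det (intmx A ^+ n - 1) != 0.
Proof.
move=> n0; rewrite (det_pow_sub1 Wu WA) -normr_gt0.
have /andP[h _] := hyperbolic_prod_bounds d0 d01 n0.
have r0 : 0 < `|d 0 0| by rewrite (lt_trans ltr01).
apply: lt_le_trans h; rewrite mulr_gt0 ?exprn_gt0 // subr_gt0 invf_lt1 //.
Qed.

(** A small [A]-orbit of [q] lifts to an orbit of the linear map; periodicity
    then gives a vector fixed by [A^n], which must be 0.  The constant [e] does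
    not depend on [n]. *)
Lemma expansive_periodic : exists2 e : R, 0 < e & forall n q, (0 < n)%N ->
  torus_action (A ^+ n) q = q ->
  (forall i, (i < n)%N -> torus_small e (torus_action (A ^+ i) q)) -> q = 0.
Proof.
have [e e0 eP] := torus_lift_equivariant A; exists e => // n q n0 qn qs.
have {}qs i : (i <= n)%N -> torus_small e (torus_action (A ^+ i) q).
  rewrite leq_eqVlt => /orP[/eqP->|]; last exact: qs.
  by rewrite qn; have := qs _ n0; rewrite expr0 torus_action1.
have lE i : (i <= n)%N ->
    torus_lift (torus_action (A ^+ i) q) = intmx A ^+ i *m torus_lift q.
  elim: i => [|i IH] le_in; first by rewrite !expr0 torus_action1 mul1mx.
  have qS := qs _ le_in; rewrite torus_action_exprS in qS *.
  have qi := qs _ (ltnW le_in).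
  by rewrite (eP _ qi qS) (IH (ltnW le_in)) exprS -mulmxE mulmxA.
apply: torus_lift_eq0; have := lE n (leqnn n); rewrite qn => e1.
have u : intmx A ^+ n - 1 \in unitmx by rewrite unitmxE unitfE det_pow_sub1_neq0.
by rewrite -[LHS](mulKmx u) mulmxBl -e1 mul1mx subrr mulmx0.
Qed.

(** A small two-sided orbit lifts to a bounded two-sided orbit of the linear
    map [A^n].  Its unstable coordinate is bounded in the future and its stable
    coordinate in the past, so both vanish. *)
Lemma expansive_two_sided n : (0 < n)%N ->
  exists2 e : R, 0 < e & forall x : int -> torus2 R,
    (forall k, x (k + 1) = torus_action (A ^+ n) (x k)) ->
    (forall k, torus_small e (x k)) -> x 0 = 0.
Proof.
move=> n0; have [e e0 eP] := torus_lift_equivariant (A ^+ n).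
exists e => // x xS xs; pose z k : 'cV[R]_2 := W *m torus_lift (x k).
pose M := (\sum_k \sum_j `|W k j|) * e.
have zM k i : `|z k i 0| <= M.
  by apply: mulmx_bound => j; rewrite mxE norm_short_lift ltW // xs.
have zS k i : z (k + 1) i 0 = d 0 i ^+ n * z k i 0.
  rewrite /z xS eP //; last by rewrite -xS.
  by rewrite intmxX (diag_coord WA).
have zD i (k : int) (j : nat) : z (k + j%:Z) i 0 = d 0 i ^+ (n * j) * z k i 0.
  elim: j => [|j IH]; first by rewrite addr0 muln0 mul1r.
  rewrite (_ : k + j.+1%:Z = k + j%:Z + 1); last by lia.
  by rewrite zS IH mulrA -exprD mulnS.
have r1 : 1 < `|d 0 0| ^+ n by rewrite exprn_egt1 // -lt0n.
have z0 : z 0 = 0.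
  apply/matrixP => i j; rewrite (ord1 j) {j} [RHS]mxE.
  apply: (geometric_bounded_eq0 r1 (M := M)) => k; rewrite -exprM.
  case: (ord2P i) => ->.
    by rewrite -normrX -normrM mulrC -zD.
  have -> : z 0 = z (- k%:Z + k%:Z) by rewrite addNr.
  by rewrite zD normrM normrX mulrC mulrA -exprMn -normrM d01 expr1n mul1r.
apply: torus_lift_eq0; rewrite -[LHS](mulKmx Wu) -/(z 0).
by rewrite z0 mulmx0.
Qed.

(** For [v] close to [w] the sequence [f (v + k b) - f (w + k b)] is a small
    two-sided orbit of [A^n], hence zero. *)
Lemma equivariant_constant n (b : R) (f : R -> torus2 R) : (0 < n)%N ->
  (forall w, f (w + b) = torus_action (A ^+ n) (f w)) ->
  (forall e, 0 < e -> exists2 c, 0 < c &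
     forall v w, `|v - w| < c -> torus_small e (f v - f w)) ->
  forall v w, f v = f w.
Proof.
move=> n0 fb uf; have [e e0 eP] := expansive_two_sided n0.
have [c c0 cP] := uf e e0.
apply: (locally_constant c0) => v w vw; apply/eqP; rewrite -subr_eq0; apply/eqP.
have := eP (fun k => f (v + k%:~R * b) - f (w + k%:~R * b)).
rewrite !mul0r !addr0; apply=> k.
  by rewrite intrD mulrDl mul1r !addrA !fb (raddfB (torus_action _)).
by apply: cP; rewrite opprD addrACA subrr addr0.
Qed.
End Hyp.
End Expansivity.

(** * Invariant tori are translates of the linearizing graph *)

Section Classification.
Context {R : realType}.
Local Notation intmx A := (map_mx intr A : 'M[R]_2).

Lemma torus_ballE (x y : torus2 R) (e : R) : 0 < e ->
  ball x e y <-> torus_small e (y - x).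
Proof.
move=> e0; split=> [[_ xy] i|xy]; first by have := xy i 0; rewrite cballE /= !mxE.
by split=> // i j; rewrite (ord1 j) cballE /=; have := xy i; rewrite !mxE.
Qed.

Lemma torus_smallD (e1 e2 : R) (x y : torus2 R) :
  torus_small e1 x -> torus_small e2 y -> torus_small (e1 + e2) (x + y).
Proof.
by move=> xs ys i; rewrite mxE (le_lt_trans (cnormD _ _)) // ltrD.
Qed.

Lemma torus_smallN (e : R) (x : torus2 R) : torus_small e x -> torus_small e (- x).
Proof. by move=> xs i; rewrite mxE cnormN. Qed.

Lemma unif_cont_mod1v (G : R -> 'cV[R]_2) (e : R) : 0 < e ->
    (forall i, unif_cont (fun w => G w i 0)) ->
  exists2 c, 0 < c & forall v w, `|v - w| < c ->
    torus_small e (mod1v (G v) - mod1v (G w)).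
Proof.
move=> e0 uG; have [c c0 cP] := uG 0 e e0; have [d d0 dP] := uG 1 e e0.
exists (Num.min c d) => [|v w]; first by rewrite lt_min c0.
rewrite lt_min => /andP[/cP hc /dP hd] i; rewrite !mxE -raddfB.
by apply: le_lt_trans (cnorm_le _) _; case: (ord2P i) => ->.
Qed.

Variables (alpha : R) (A : 'M[int]_2) (h : circle R -> torus2 R) (m : nat).
Hypotheses (m_gt0 : (0 < m)%N)
    (m_int : m%:R *: degree_vector A h \is a mxOver Num.int)
    (m_min : forall k : nat, (0 < k)%N ->
       k%:R *: degree_vector A h \is a mxOver Num.int -> (m <= k)%N).
Variables (G : R -> 'cV[R]_2).
Hypotheses (uG : forall i, unif_cont (fun w => G w i 0))
  (G1 : forall w, G (w + 1) = G w + degree_vector A h)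
  (Gh : forall w, h (mod1 w) = mod1v (G (w + alpha) - intmx A *m G w)).
Local Notation L := (degree_vector A h).
Local Notation phi := (skew_product alpha A h).

(** The coordinates [(w, y) |-> (mod1 w, mod1v (G w) + y)] turn the skew product
    into a translation times a toral automorphism. *)
Lemma iter_skew_product n w y :
  iter n phi (mod1 w, mod1v (G w) + y) =
  (mod1 (w + n%:R * alpha), mod1v (G (w + n%:R * alpha)) + torus_action (A ^+ n) y).
Proof.
elim: n => [|n IH]; first by rewrite mul0r addr0 expr0 torus_action1.
have E : w + n.+1%:R * alpha = w + n%:R * alpha + alpha by rewrite -natr1; ring.
rewrite iterS IH /skew_product /= E [mod1 (_ + alpha)]raddfD; congr pair.
rewrite Gh (raddfD (torus_action A)) /= torus_action_mod1v raddfB /=.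
by rewrite torus_action_exprS addrC addrA subrK.
Qed.

Lemma G_shift w (k : int) : G (w + k%:~R) = G w + k%:~R *: L.
Proof.
have e x : G (x + 1) - (x + 1) *: L = G x - x *: L.
  by rewrite G1 scalerDl scale1r opprD addrACA subrr addr0.
have := periodic_shift e w k; rewrite mulr1 scalerDl => /eqP.
by rewrite subr_eq addrA subrK => /eqP.
Qed.

Definition fixed_graph p : R -> torus2 R := fun w => mod1v (G w) + p.

Lemma fixed_graph_continuous p : continuous (fixed_graph p).
Proof.
move=> w U /nbhs_ballP[e /= e0 eU]; have [c c0 cP] := unif_cont_mod1v e0 uG.
apply/nbhs_ballP; exists c => //= v wv; apply: eU; apply/torus_ballE => //.
by rewrite /fixed_graph opprD addrACA subrr addr0; apply: cP; rewrite distrC.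
Qed.

Lemma fixed_graph_eq p w (i j : nat) : (i <= j)%N ->
  fixed_graph p (w + i%:R) = fixed_graph p (w + j%:R) <->
  (j - i)%:R *: L \is a mxOver Num.int.
Proof.
move=> ij; rewrite /fixed_graph !(G_shift _ (Posz _)) !raddfD /=.
rewrite -mod1v_eq0 natrB // scalerBl raddfB /= subr_eq0.
split=> [/addIr/addrI ->//|/eqP->//].
Qed.

Lemma fixed_graph_param n p : torus_action (A ^+ n) p = p ->
  torus_parametrization alpha phi n m (fixed_graph p).
Proof.
move=> pn; split.
- exact: fixed_graph_continuous.
- move=> w k; rewrite /fixed_graph; congr (_ + p).
  have -> : k%:~R * m%:R = (k * m)%:~R :> R by rewrite intrM.
  rewrite G_shift raddfD /= intrM -scalerA [X in _ + X](_ : _ = 0) ?addr0 //.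
  apply/eqP; rewrite mod1v_eq0; apply/mxOverP => i j; rewrite mxE.
  by rewrite rpredM ?intr_int //; move/mxOverP: m_int.
- by move=> w; rewrite iter_skew_product pn.
- move=> w.
  have key i j : (i < m)%N -> (j < m)%N -> (i <= j)%N ->
      fixed_graph p (w + i%:R) = fixed_graph p (w + j%:R) -> i = j.
    move=> im jm ij /fixed_graph_eq-/(_ ij) ji.
    case: (posnP (j - i)%N) => [|ji0]; first lia.
    have := m_min ji0 ji; lia.
  move=> i j im jm; case: (leqP i j) => ij e; first exact: key.
  by apply/esym; apply: key => //; exact: ltnW.
Qed.

Definition torus_of p := torus_graph m (fixed_graph p).

(** Over the point 0 the torus of [q] is the orbit [G 0 + q + k L], and [L] has
    order dividing [m] in T^2. *)
Lemma torus_of_eq p q : torus_of p = torus_of q ->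
  exists i : 'I_m, p = q + mod1v (i%:R *: L).
Proof.
move=> pq.
have : torus_of q (mod1 0, fixed_graph p 0).
  by rewrite -pq; exists 0; split=> //; exists 0%N => //=; rewrite addr0.
move=> [w /= [/esym/eqP]]; rewrite mod1_eq subr0 => /intrP[k ->] [i _].
pose N : int := k + i; have -> : k%:~R + i%:R = 0 + N%:~R :> R by rewrite add0r intrD.
rewrite /fixed_graph G_shift raddfD /= -addrA => /addrI ->.
have mz : (m : int) != 0 by lia.
have j_lt : (`|(N %% m)%Z|%N < m)%N.
  by have := ltz_mod N mz; have := modz_ge0 N mz; lia.
exists (Ordinal j_lt); rewrite addrC; congr (_ + _) => /=.
have -> : (`|(N %% m)%Z|%N%:R : R) = (N %% m)%Z%:~R.
  by rewrite -[LHS]/((`|(N %% m)%Z|%N : int)%:~R) gez0_abs // modz_ge0.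
rewrite {1}(divz_eq N m) intrD intrM scalerDl raddfD /= -scalerA.
rewrite [X in X + _](_ : _ = 0) ?add0r //.
apply/eqP; rewrite mod1v_eq0; apply/mxOverP => a b; rewrite mxE.
by rewrite rpredM ?intr_int //; move/mxOverP: m_int.
Qed.
Hypotheses (A_unit : A \in unitmx) (A_hyp : @hyperbolic R A).

(** The period [k] of [g] makes [k L] an integer vector, so [m <= k]; and
    injectivity over a period forbids [m < k], as [m] is already a period. *)
Lemma param_fixed_graph n k g : (0 < n)%N -> (0 < k)%N ->
    torus_parametrization alpha phi n k g ->
  k = m /\ exists2 p, torus_action (A ^+ n) p = p & g = fixed_graph p.
Proof.
have [W [d [Wu WA d0 d01]]] := hyperbolic_diag A_unit A_hyp.
move=> n0 k0 [cg gT gn ginj].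
pose f w := g w - mod1v (G w).
have fn w : f (w + n%:R * alpha) = torus_action (A ^+ n) (f w).
  have := gn w; rewrite -[g w in LHS](subrKC (mod1v (G w))) iter_skew_product.
  by move=> [] e; rewrite /f -e addrAC subrr add0r.
have uf (e : R) : 0 < e -> exists2 c, 0 < c &
     forall v w, `|v - w| < c -> torus_small e (f v - f w).
  move=> e0; have e2 : 0 < e / 2 by rewrite divr_gt0.
  have [c c0 cP] := unif_cont_mod1v e2 uG.
  have kT : 0 < k%:R :> R by rewrite ltr0n.
  have gk w : g (w + k%:R) = g w by rewrite (gT w 1) mul1r.
  have [c' c'0 c'P] := periodic_unif_continuous kT gk cg e2.
  exists (Num.min c c') => [|v w]; first by rewrite lt_min c0.
  rewrite lt_min => /andP[vw vw'].
  rewrite /f opprD addrACA -opprD [e]splitr; apply: torus_smallD.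
    by apply/torus_ballE => //; apply: c'P; rewrite distrC.
  exact/torus_smallN/cP.
pose p := f 0.
have fp w : f w = p by exact: (equivariant_constant Wu WA d0 d01 n0 fn uf).
have gE : g = fixed_graph p.
  by apply/funext => w; rewrite /fixed_graph -(fp w) /f subrKC.
have pn : torus_action (A ^+ n) p = p by rewrite -fn fp.
split; last by exists p.
apply/eqP; rewrite eqn_leq; apply/andP; split.
  rewrite leqNgt; apply/negP => mk.
  have := ginj 0 0%N m k0 mk; rewrite gE; move=> /(_ _)/esym.
  move=> H; have : m = 0%N; last by lia.
  by apply: H; apply/fixed_graph_eq; rewrite ?subn0.
apply: m_min => //.
rewrite -[k]subn0; apply/(fixed_graph_eq p 0 (leq0n k)); rewrite -gE.
by rewrite addr0 (gT 0 1) mul1r.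
Qed.

Lemma invariant_torusP n S : (0 < n)%N ->
  invariant_torus alpha phi n m S <->
  exists2 p, torus_action (A ^+ n) p = p & S = torus_of p.
Proof.
move=> n0; split=> [[g gP ->]|[p pn ->]].
  by have [_ [p pn ->]] := param_fixed_graph n0 m_gt0 gP; exists p.
by exists (fixed_graph p) => //; exact: fixed_graph_param.
Qed.

Lemma all_toriE :
  all_tori alpha phi = \bigcup_(n in [set n : nat | (0 < n)%N]) tori alpha phi n m.
Proof.
apply/seteqP; split=> S.
  move=> [n [k [n0 k0 [g gP SE]]]]; have [km _] := param_fixed_graph n0 k0 gP.
  exists n => //; exists n; split; first by rewrite n0 leqnn.
  by exists g; rewrite -km.
move=> [n _ [k [/andP[k0 _] Sk]]]; exists k, m; split=> //.
Qed.

End Classification.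

(** * Exponential growth rates *)

Section Growth.
Context {R : realType}.

Lemma cvg_log_growth (c r : R) : 0 < c -> 0 < r ->
  n%:R^-1 * ln (c * r ^+ n) @[n --> \oo] --> ln r.
Proof.
move=> c0 r0.
have cvg1 : n%:R^-1 * ln c + ln r @[n --> \oo] --> 0 * ln c + ln r.
  apply: cvgD; last exact: cvg_cst.
  apply: cvgM; last exact: cvg_cst.
  by rewrite -cvg_shiftS; exact: cvg_harmonic.
rewrite mul0r add0r in cvg1; apply: cvg_trans cvg1; apply: near_eq_cvg.
near=> n; have n0 : (0 < n)%N by near: n; exists 1%N.
rewrite lnM ?posrE ?exprn_gt0 // lnXn // mulrDr -[ln r *+ n]mulr_natl mulKf //.
by rewrite pnatr_eq0 -lt0n.
Unshelve. all: by end_near.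
Qed.

Lemma cvg_log_squeeze (a b r : R) (u : nat -> R) : 0 < a -> 0 < r ->
  (forall n, (0 < n)%N -> a * r ^+ n <= u n <= b * r ^+ n) ->
  n%:R^-1 * ln (u n) @[n --> \oo] --> ln r.
Proof.
move=> a0 r0 uab.
have b0 : 0 < b.
  have /andP[+ h] := uab 1%N isT => /le_trans/(_ h).
  by rewrite ler_pM2r ?exprn_gt0 // => /(lt_le_trans a0).
apply: squeeze_cvgr (cvg_log_growth a0 r0) (cvg_log_growth b0 r0).
near=> n; have n0 : (0 < n)%N by near: n; exists 1%N.
have rn : 0 < r ^+ n by rewrite exprn_gt0.
have /andP[h1 h2] := uab _ n0.
have u0 : 0 < u n by apply: lt_le_trans h1; rewrite mulr_gt0.
by rewrite !ler_wpM2l ?invr_ge0 // ler_ln // posrE mulr_gt0.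
Unshelve. all: by end_near.
Qed.

Lemma limn_esup_le_near (v : nat -> \bar R) (u : nat -> R) (l : R) :
  u @ \oo --> l -> (\forall n \near \oo, (v n <= (u n)%:E)%E) ->
  (limn_esup v <= l%:E)%E.
Proof.
move=> ul vu; apply/lee_addgt0Pr => e e0.
have ue : \forall n \near \oo, u n <= l + e by apply: (cvgr_le _ ul); rewrite ltrDl.
apply: (@le_trans _ _ (ereal_sup [set v n | n in [set n | (v n <= (l + e)%:E)%E]])).
  rewrite /limn_esup limf_esupE; apply: ereal_inf_lbound.
  exists [set n | (v n <= (l + e)%:E)%E] => //.
  by apply: filterS2 vu ue => n h1 h2; apply: le_trans h1 _; rewrite lee_fin.
by apply: ge_ereal_sup => _ [n /= nP <-]; rewrite -EFinD.
Qed.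

Lemma limn_esup_ge_near (v : nat -> \bar R) (u : nat -> R) (l : R) :
  u @ \oo --> l -> (\forall n \near \oo, ((u n)%:E <= v n)%E) ->
  (l%:E <= limn_esup v)%E.
Proof.
move=> ul vu; rewrite /limn_esup limf_esupE; apply: le_ereal_inf_tmp => _ [V VF <-].
apply/lee_subgt0Pr => e e0.
have ue : \forall n \near \oo, l - e <= u n by apply: (cvgr_ge _ ul); rewrite gtrBl.
have [n [Vn [h1 h2]]] := filter_ex (filterI VF (filterI vu ue)).
apply: (@le_trans _ _ (v n)); last by apply: ereal_sup_ubound; exists n.
by apply: le_trans h1; rewrite -EFinB lee_fin.
Qed.
End Growth.

(** * Counting the invariant tori *)

Section Counting.
Context {R : realType}.
Local Notation intmx A := (map_mx intr A : 'M[R]_2).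

Lemma geometric_sum_bound (r : R) n : 1 < r ->
  \sum_(k < n) r ^+ k.+1 <= r / (r - 1) * r ^+ n.
Proof.
move=> r1; have r10 : 0 < r - 1 by lra.
have -> : \sum_(k < n) r ^+ k.+1 = r * \sum_(k < n) r ^+ k.
  by rewrite mulr_sumr; apply: eq_bigr => k _; rewrite exprS.
rewrite -mulrA ler_pM2l; last by lra.
rewrite mulrC ler_pdivlMr // mulrC -subrX1.
lra.
Qed.

Lemma fset_bigU (T : choiceType) (K : nat -> {fset T}) (n : nat) :
  exists2 U : {fset T}, (#|` U| <= \sum_(k < n) #|` K k.+1|)%N &
    forall x, x \in U <-> exists2 k, (0 < k <= n)%N & x \in K k.
Proof.
elim: n => [|n [U Un UP]].
  exists fset0 => [|x]; first by rewrite cardfs0.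
  by split=> [//|[k]]; case: k.
exists (U `|` K n.+1)%fset => [|x].
  by rewrite big_ord_recr /= (leq_trans (leq_card_fsetU _ _)) // leq_add2r.
rewrite in_fsetU; split=> [/orP[/UP[k kn xk]|xn]|[k kn xk]].
- by case/andP: kn => k0 kn; exists k; rewrite ?k0 ?leqW.
- by exists n.+1; rewrite ?leqnn.
- case: (eqVneq k n.+1) => [kE|kn1]; first by rewrite -kE xk orbT.
  by apply/orP; left; apply/UP; exists k => //; case/andP: kn => -> /=; lia.
Qed.

Lemma uniq_fset_leq (T : choiceType) (E : {fset T}) (s : seq T) :
  {subset E <= s} -> (#|` E| <= size s)%N.
Proof. by move=> Es; apply: uniq_leq_size => //; exact: fset_uniq. Qed.

Lemma fixed_points (A : 'M[int]_2) (W : 'M[R]_2) (d : 'rV[R]_2) n :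
    W \in unitmx -> W *m intmx A = diag_mx d *m W ->
    1 < `|d 0 0| -> `|d 0 0 * d 0 1| = 1 -> (0 < n)%N ->
  exists2 K : {fset torus2 R},
    #|` K|%:R = `|(d 0 0 ^+ n - 1) * (d 0 1 ^+ n - 1)| &
    forall x, (x \in K) = (torus_action (A ^+ n) x == x).
Proof.
move=> Wu WA d0 d01 n0.
have detE : (\det (A ^+ n - 1))%:~R = (d 0 0 ^+ n - 1) * (d 0 1 ^+ n - 1).
  by rewrite -(det_pow_sub1 Wu WA) -det_map_mx map_mxB intmxX map_mx1.
have det0 : \det (A ^+ n - 1) != 0.
  rewrite -(intr_eq0 R) detE -(det_pow_sub1 Wu WA).
  exact: (det_pow_sub1_neq0 Wu WA d0 d01 n0).
have [K cK KP] := torus_kernel (R := R) det0.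
exists K => [|x]; first by rewrite cK -detE -intr_norm -abszE.
by rewrite KP torus_actionB torus_action1 subr_eq0.
Qed.

(** Stated for any description of the tori by periodic points that is at most
    [m]-to-one, with [v] listing the possible differences in a fibre. *)
Lemma tori_count (alpha : R) (A : 'M[int]_2) (h : circle R -> torus2 R) (m : nat)
    (W : 'M[R]_2) (d : 'rV[R]_2) (torus_of : torus2 R -> set (circle R * torus2 R))
    (v : 'I_m -> torus2 R) :
    W \in unitmx -> W *m intmx A = diag_mx d *m W ->
    1 < `|d 0 0| -> `|d 0 0 * d 0 1| = 1 -> (0 < m)%N ->
    (forall n S, (0 < n)%N -> invariant_torus alpha (skew_product alpha A h) n m S <->
      exists2 p, torus_action (A ^+ n) p = p & S = torus_of p) ->
    (forall p q, torus_of p = torus_of q -> exists i, p = q + v i) ->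
  let T n := tori alpha (skew_product alpha A h) n m in
  (forall n, finite_set (T n)) /\
  exists a, exists b, 0 < a /\ forall n, (0 < n)%N ->
    a * `|d 0 0| ^+ n <= #|` fset_set (T n)|%:R <= b * `|d 0 0| ^+ n.
Proof.
move=> Wu WA d0 d01 m0 torusP torus_inj T; set r := `|d 0 0| in d0 *.
have Kex n : exists K : {fset torus2 R}, (0 < n)%N ->
    #|` K|%:R = `|(d 0 0 ^+ n - 1) * (d 0 1 ^+ n - 1)| /\
    forall x, (x \in K) = (torus_action (A ^+ n) x == x).
  case: n => [|n]; first by exists fset0.
  by have [K cK KP] := fixed_points Wu WA d0 d01 (ltn0Sn n); exists K.
have /choice[K KP] := Kex => {Kex}.
have Tex n : exists2 F : {fset set (circle R * torus2 R)},
    T n = [set` F] & (#|` F| <= \sum_(k < n) #|` K k.+1|)%N.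
  have [U cU UP] := fset_bigU K n.
  exists [fset torus_of p | p in U]%fset.
    apply/seteqP; split=> S /=.
      move=> [k [kn /torusP[|p pk ->]]]; first by case/andP: kn.
      apply/imfsetP; exists p => //=; apply/UP; exists k => //.
      by have [_ ->] := KP k ltac:(by case/andP: kn); apply/eqP.
    move=> /imfsetP[p /= /UP[k kn pk] ->]; exists k; split=> //.
    have k0 : (0 < k)%N by case/andP: kn.
    apply/torusP => //; exists p => //; have [_ e] := KP k k0.
    by apply/eqP; rewrite -e.
  by apply: leq_trans cU; exact: leq_imfset_card.
split=> [n|]; first by have [F -> _] := Tex n.
exists ((1 - r^-1) ^+ 2 / m%:R), (4 * (r / (r - 1))); split.
  rewrite divr_gt0 ?ltr0n // exprn_gt0 // subr_gt0 invf_lt1 //; lra.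
move=> n n0; have [F TF cF] := Tex n; rewrite TF set_fsetK; apply/andP; split.
  (* [s] picks one point per torus; translating by the [v i] recovers all the
     points fixed by [A^n] *)
  pose s S := xget 0 [set p | torus_of p = S].
  have sP p : torus_of (s (torus_of p)) = torus_of p.
    exact: (xgetPex 0 (ex_intro (fun q => torus_of q = torus_of p) p erefl)).
  have /uniq_fset_leq : {subset K n <=
      [seq s Z + v i | Z <- enum_fset F, i <- enum 'I_m]}.
    move=> p pK; have [i pE] := torus_inj _ _ (esym (sP p)).
    apply/allpairsP; exists (torus_of p, i) => /=; rewrite mem_enum; split=> //.
    have : T n (torus_of p).
      exists n; rewrite n0 leqnn; split=> //; apply/torusP => //; exists p => //.
      by apply/eqP; have [_ <-] := KP n n0.
    by rewrite TF.
  rewrite size_allpairs size_enum_ord -(ler_nat R) natrM.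
  have [-> _] := KP n n0 => h1.
  have /andP[h2 _] := hyperbolic_prod_bounds d0 d01 n0.
  rewrite mulrAC ler_pdivrMr ?ltr0n //.
  exact: le_trans h2 h1.
apply: (@le_trans _ _ (\sum_(k < n) #|` K k.+1|)%:R); first by rewrite ler_nat.
rewrite natr_sum -mulrA.
apply: (@le_trans _ _ (4 * \sum_(k < n) r ^+ k.+1)); last first.
  by rewrite ler_pM2l // geometric_sum_bound.
rewrite mulr_sumr; apply: ler_sum => k _; have [-> _] := KP k.+1 isT.
by have /andP[_] := hyperbolic_prod_bounds d0 d01 (ltn0Sn k).
Qed.
End Counting.

(** * Entropy of the skew product *)

Section EntropyBounds.
Context {R : realType} {X : pseudoMetricType R}.
Implicit Types (f : X -> X) (e r a b : R).

Lemma max_separated_ge0 f n e : (0 <= max_separated f n e)%E.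
Proof.
by apply: ereal_sup_ubound; exists fset0; rewrite ?cardfs0.
Qed.

Lemma entropy_at_le f e b r : 0 < b -> 0 < r ->
  (forall n, (0 < n)%N -> (max_separated f n e <= (b * r ^+ n)%:E)%E) ->
  (entropy_at f e <= (ln r)%:E)%E.
Proof.
move=> b0 r0 fb; apply: (limn_esup_le_near (cvg_log_growth b0 r0)).
near=> n; have n0 : (0 < n)%N by near: n; exists 1%N.
have br0 : 0 < b * r ^+ n by rewrite mulr_gt0 ?exprn_gt0.
rewrite EFinM -lne_EFin // lee_wpmul2l ?lee_fin ?invr_ge0 //.
rewrite lee_lne ?fb // in_itv /= leey ?max_separated_ge0 // lee_fin ltW //.
Unshelve. all: by end_near.
Qed.

Lemma entropy_at_ge f e a r : 0 < a -> 0 < r ->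
  (forall n, (0 < n)%N -> ((a * r ^+ n)%:E <= max_separated f n e)%E) ->
  ((ln r)%:E <= entropy_at f e)%E.
Proof.
move=> a0 r0 fa; apply: (limn_esup_ge_near (cvg_log_growth a0 r0)).
near=> n; have n0 : (0 < n)%N by near: n; exists 1%N.
have ar0 : 0 < a * r ^+ n by rewrite mulr_gt0 ?exprn_gt0.
rewrite EFinM -lne_EFin // lee_wpmul2l ?lee_fin ?invr_ge0 //.
rewrite lee_lne ?fa // in_itv /= leey ?max_separated_ge0 // lee_fin ltW //.
Unshelve. all: by end_near.
Qed.

(** Two points of a separated set cannot have the same code. *)
Lemma max_separated_le_card (F : finType) (code : X -> F) f n e :
  (forall x y, code x = code y ->
     forall i, (i < n)%N -> ball (iter i f x) e (iter i f y)) ->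
  (max_separated f n e <= (#|F|%:R)%:E)%E.
Proof.
move=> codeP; apply: ge_ereal_sup => _ [E /= sepE <-]; rewrite lee_fin ler_nat.
rewrite -(size_map code) cardE; apply: uniq_leq_size.
  rewrite map_inj_in_uniq ?fset_uniq // => x y xE yE xy.
  by apply: sepE => // i; exact: codeP.
by move=> z _; rewrite mem_enum.
Qed.
End EntropyBounds.

Lemma truncn_eq_dist (R : realType) (x y : R) : 0 <= x -> 0 <= y ->
  Num.truncn x = Num.truncn y -> `|x - y| < 1.
Proof.
move=> x0 y0 xy; have /andP[x1 x2] := truncn_itv x0.
have /andP[y1 y2] := truncn_itv y0; rewrite xy -natr1 in x1 x2.
rewrite -natr1 in y2; rewrite ltr_norml; lra.
Qed.

Section SkewEntropy.
Context {R : realType}.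
Local Notation intmx A := (map_mx intr A : 'M[R]_2).
Variables (alpha : R) (A : 'M[int]_2) (h : circle R -> torus2 R).
Variables (G : R -> 'cV[R]_2) (W : 'M[R]_2) (d : 'rV[R]_2).
Hypotheses (uG : forall i, unif_cont (fun w => G w i 0))
  (Gh : forall w, h (mod1 w) = mod1v (G (w + alpha) - intmx A *m G w)).
Hypotheses (Wu : W \in unitmx) (WA : W *m intmx A = diag_mx d *m W).
Hypotheses (d0 : 1 < `|d 0 0|) (d01 : `|d 0 0 * d 0 1| = 1).
Local Notation phi := (skew_product alpha A h).
Local Notation r := `|d 0 0|.

(** Over the base point 0, the points fixed by [A^n] have pairwise differences
    fixed by [A^n], so expansivity separates them. *)
Lemma max_separated_lower : exists2 e : R, 0 < e &
  exists2 a : R, 0 < a &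
    forall n, (0 < n)%N -> ((a * r ^+ n)%:E <= max_separated phi n e)%E.
Proof.
have [e e0 eP] := expansive_periodic Wu WA d0 d01; exists e => //.
exists ((1 - r^-1) ^+ 2).
  by rewrite exprn_gt0 // subr_gt0 invf_lt1 // (lt_trans ltr01).
move=> n n0; have [K cK KP] := fixed_points Wu WA d0 d01 n0.
pose pt p := (mod1 0 : circle R, mod1v (G 0) + p).
have ptI : injective pt by move=> p q [] /addrI.
apply: (@le_trans _ _ (#|` [fset pt p | p in K]%fset|%:R)%:E).
  rewrite card_imfset //= cK lee_fin.
  by have /andP[] := hyperbolic_prod_bounds d0 d01 n0.
apply: ereal_sup_ubound; exists [fset pt p | p in K]%fset => //=.
move=> _ _ /imfsetP[p /= pK ->] /imfsetP[q /= qK ->] pq; congr pt.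
apply/eqP; rewrite eq_sym -subr_eq0; apply/eqP; apply: (eP n) => // [|i /pq].
  by rewrite raddfB /=; congr (_ - _); apply/eqP; rewrite -KP.
rewrite !(iter_skew_product Gh) => -[_ /(torus_ballE _ _ e0)].
by rewrite /= opprD addrACA subrr add0r raddfB.
Qed.

Lemma torus_fundamental_domain (x : circle R * torus2 R) :
  exists wY : R * 'cV[R]_2, [/\ x = (mod1 wY.1, mod1v (G wY.1) + mod1v wY.2),
    0 <= wY.1 <= 1 & forall i, `|wY.2 i 0| <= 1].
Proof.
have frac (a : circle R) : exists2 z : R, mod1 z = a & 0 <= z <= 1.
  have [z <-] := mod1_surj a; exists (z - (Num.floor z)%:~R).
    by apply/eqP; rewrite mod1_eq addrAC subrr sub0r rpredN intr_int.
  have := floor_le_tmp z; have := floorD1_gt z; rewrite intrD1; lra.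
have [w wE w01] := frac x.1.
have /choice[Y YP] : forall i, exists z : R,
    mod1 z = (x.2 - mod1v (G w)) i 0 /\ `|z| <= 1.
  move=> i; have [z zE z01] := frac ((x.2 - mod1v (G w)) i 0).
  by exists z; split=> //; rewrite ger0_norm; case/andP: z01.
exists (w, \col_i Y i); split=> // [|i]; last by rewrite mxE; case: (YP i).
rewrite [LHS]surjective_pairing /= -wE; congr pair.
rewrite (_ : mod1v (\col_i Y i) = x.2 - mod1v (G w)) ?subrKC //.
by apply/matrixP => i j; rewrite (ord1 j); have [+ _] := YP i; rewrite !mxE.
Qed.

(** The code of a point records the cells of its base coordinate, of its unstable
    coordinate in a grid of mesh [s / rho^n], and of its stable coordinate in a
    grid of mesh [s].  Only the second grid grows with [n]. *)
Lemma max_separated_upper (e : R) : 0 < e -> exists2 b : R, 0 < b &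
    forall n, (0 < n)%N -> (max_separated phi n e <= (b * r ^+ n)%:E)%E.
Proof.
move=> e0; have e2 : 0 < e / 2 by rewrite divr_gt0.
have [c' c'0 c'P] := unif_cont_mod1v e2 uG.
pose c := Num.min c' e; have c0 : 0 < c by rewrite lt_min c'0.
pose SV : R := \sum_k \sum_j `|invmx W k j|.
pose M : R := (\sum_k \sum_j `|W k j|) * 1.
have SV0 : 0 <= SV by apply: sumr_ge0 => k _; apply: sumr_ge0.
have M0 : 0 <= M by rewrite /M mulr1; apply: sumr_ge0 => k _; apply: sumr_ge0.
(* chosen so that eigencoordinates at most [s] give coordinates below [e / 2] *)
pose s := e / 2 / (SV + 1); have s0 : 0 < s by rewrite divr_gt0 //; lra.
have SVs : SV * s < e / 2.
  rewrite /s mulrA ltr_pdivrMr; last by lra.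
  by rewrite mulrC ltr_pM2l //; lra.
have /choice[rep repP] := torus_fundamental_domain.
have r0 : 0 < r by rewrite (lt_trans ltr01).
pose b := (c^-1 + 1) * (2 * M / s + 1) * (2 * M / s + 1).
have Ms0 : 0 <= 2 * M / s by apply: divr_ge0; [apply: mulr_ge0|apply: ltW].
have c10 : 0 < c^-1 + 1 by rewrite ltr_wpDl // invr_ge0 ltW.
have Ms10 : 0 < 2 * M / s + 1 by rewrite ltr_wpDl.
exists b; first by rewrite !mulr_gt0.
move=> n n0; have rn1 : 1 <= r ^+ n by rewrite exprn_ege1 // ltW.
have rn0 : 0 < r ^+ n by lra.
(* the shifts by [M] make the three quantities nonnegative *)
pose zu x := ((W *m (rep x).2) 0 0 + M) * (r ^+ n / s).
pose zs x := ((W *m (rep x).2) 1 0 + M) / s.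
pose zw x := (rep x).1 / c.
have WM x i : `|(W *m (rep x).2) i 0| <= M.
  by apply: mulmx_bound; case: (repP x).
have zM x i : 0 <= (W *m (rep x).2) i 0 + M <= 2 * M.
  have := WM x i; rewrite ler_norml => /andP[h1 h2].
  by apply/andP; split; lra.
have rs0 : 0 < r ^+ n / s by rewrite divr_gt0.
have zu01 x : 0 <= zu x <= 2 * M / s * r ^+ n.
  have /andP[h1 h2] := zM x 0.
  rewrite mulr_ge0 //= ?(ltW rs0) //.
  by rewrite (_ : 2 * M / s * r ^+ n = 2 * M * (r ^+ n / s)) ?ler_pM2r //; ring.
have zs01 x : 0 <= zs x <= 2 * M / s.
  have /andP[h1 h2] := zM x 1.
  by rewrite divr_ge0 ?(ltW s0) //= ler_pM2r ?invr_gt0.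
have zw01 x : 0 <= zw x <= c^-1.
  have [_ /andP[h1 h2] _] := repP x.
  by rewrite divr_ge0 ?(ltW c0) //= -[leRHS]mul1r ler_pM2r ?invr_gt0.
pose Nu := Num.truncn (2 * M / s * r ^+ n).
pose Ns := Num.truncn (2 * M / s).
pose Nw := Num.truncn c^-1.
pose code x : 'I_Nw.+1 * 'I_Nu.+1 * 'I_Ns.+1 :=
  (inord (Num.truncn (zw x)), inord (Num.truncn (zu x)), inord (Num.truncn (zs x))).
have codeP x y : code x = code y ->
    [/\ `|zw x - zw y| < 1, `|zu x - zu y| < 1 & `|zs x - zs y| < 1].
  have key (z B : R) : 0 <= z <= B -> (Num.truncn z < (Num.truncn B).+1)%N.
    by move=> /andP[z0 zB]; rewrite ltnS le_truncn.
  move=> [] /(congr1 val) + /(congr1 val) + /(congr1 val).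
  rewrite /= !inordK ?(key _ _ (zw01 _)) ?(key _ _ (zu01 _)) ?(key _ _ (zs01 _)) //.
  by move=> h1 h2 h3; split; apply: truncn_eq_dist => //;
    [case/andP: (zw01 x)|case/andP: (zw01 y)|case/andP: (zu01 x)
    |case/andP: (zu01 y)|case/andP: (zs01 x)|case/andP: (zs01 y)].
apply: (@le_trans _ _ (#|{: 'I_Nw.+1 * 'I_Nu.+1 * 'I_Ns.+1}|%:R)%:E).
  apply: (max_separated_le_card (code := code)) => x y /codeP[hw hu hs] i i_n.
  have [xE _ _] := repP x; have [yE _ _] := repP y.
  set wx := (rep x).1 in xE; set wy := (rep y).1 in yE.
  set Yx := (rep x).2 in xE; set Yy := (rep y).2 in yE.
  have wc : `|wy - wx| < c.
    move: hw; rewrite /zw -/wx -/wy -mulrBl normrM normfV (gtr0_norm c0).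
    by rewrite ltr_pdivrMr // mul1r distrC.
  have [wc' we] : `|wy - wx| < c' /\ `|wy - wx| < e.
    by apply/andP; rewrite -lt_min.
  have shift : wy + i%:R * alpha - (wx + i%:R * alpha) = wy - wx.
    by rewrite opprD addrACA subrr addr0.
  rewrite xE yE !(iter_skew_product Gh); split=> /=.
    by rewrite cballE /= -raddfB; apply: le_lt_trans (cnorm_le _) _; rewrite shift.
  apply/torus_ballE => //; rewrite opprD addrACA [e]splitr; apply: torus_smallD.
    by apply: c'P; rewrite shift.
  rewrite !torus_action_mod1v -raddfB /= -mulmxBr => j.
  rewrite mxE (le_lt_trans (cnorm_le _)) // (le_lt_trans _ SVs) //.
  rewrite intmxX -[_ *m (Yy - Yx)](mulKmx Wu).
  apply: mulmx_bound => k; rewrite (diag_coord WA) normrM normrX mulmxBr.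
  rewrite [(W *m Yy - _) k 0]mxE [(- (W *m Yx)) k 0]mxE distrC.
  case: (ord2P k) => ->.
    have h1 : `|(W *m Yx) 0 0 - (W *m Yy) 0 0| * (r ^+ n / s) < 1.
      move: hu; rewrite /zu -/Yx -/Yy -mulrBl opprD addrACA subrr addr0 normrM.
      by rewrite [X in _ * X]gtr0_norm.
    rewrite mulrA ltr_pdivrMr // mul1r in h1.
    apply: le_trans (ltW h1); rewrite mulrC ler_wpM2l //.
    by apply: ler_weXn2l; [exact: ltW|exact: ltnW].
  have h1 : `|(W *m Yx) 1 0 - (W *m Yy) 1 0| < s.
    move: hs; rewrite /zs -/Yx -/Yy -mulrBl opprD addrACA subrr addr0 normrM.
    by rewrite normfV (gtr0_norm s0) ltr_pdivrMr // mul1r.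
  apply: le_trans (ltW h1); rewrite ler_piMl // exprn_ile1 //.
  by rewrite -(ler_pM2l r0) mulr1 -normrM d01 ltW.
rewrite lee_fin !card_prod !card_ord !natrM.
have hNu : (Nu.+1%:R : R) <= (2 * M / s + 1) * r ^+ n.
  rewrite -natr1 mulrDl mul1r; apply: lerD => //.
  by rewrite truncn_le mulr_ge0 // ltW.
have hNs : (Ns.+1%:R : R) <= (2 * M / s + 1).
  by rewrite -natr1 lerD2r truncn_le.
have hNw : (Nw.+1%:R : R) <= (c^-1 + 1).
  by rewrite -natr1 lerD2r truncn_le invr_ge0 ltW.
rewrite (_ : b * r ^+ n = (c^-1 + 1) * ((2 * M / s + 1) * r ^+ n) * (2 * M / s + 1)).
  by rewrite !ler_pM // mulr_ge0.
by rewrite /b; ring.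
Qed.
End SkewEntropy.

Lemma htop_skew_product (R : realType) (alpha : R) (A : 'M[int]_2)
    (h : circle R -> torus2 R) (G : R -> 'cV[R]_2) (W : 'M[R]_2) (d : 'rV[R]_2) :
  (forall i, unif_cont (fun w => G w i 0)) ->
  (forall w, h (mod1 w) = mod1v (G (w + alpha) - map_mx intr A *m G w)) ->
  W \in unitmx -> W *m map_mx intr A = diag_mx d *m W ->
  1 < `|d 0 0| -> `|d 0 0 * d 0 1| = 1 ->
  htop (skew_product alpha A h) = (ln `|d 0 0|)%:E.
Proof.
move=> uG Gh Wu WA d0 d01; have r0 : 0 < `|d 0 0| := lt_trans ltr01 d0.
apply/eqP; rewrite eq_le; apply/andP; split.
  apply: ge_ereal_sup => _ [e /= e0 <-].
  have [b b0 bP] := max_separated_upper uG Gh Wu WA d0 d01 e0.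
  exact: entropy_at_le b0 r0 bP.
have [e e0 [a a0 aP]] := max_separated_lower Gh Wu WA d0 d01.
apply: le_trans (entropy_at_ge a0 r0 aP) _.
by apply: ereal_sup_ubound; exists e.
Qed.

Theorem theorem1p2 (R : realType) (alpha : R) (A : 'M[int]_2)
    (h : circle R -> torus2 R) (m : nat)
    (alpha_irr : irrational alpha)
    (A_GL2 : A \in unitmx)
    (A_hyp : @hyperbolic R A)
    (h_cont : continuous h)
    (m_gt0 : (0 < m)%N)
    (m_int : m%:R *: degree_vector A h \is a mxOver Num.int)
    (m_min : forall k : nat, (0 < k)%N ->
       k%:R *: degree_vector A h \is a mxOver Num.int -> (m <= k)%N) :
  let phi := skew_product alpha A h in
  [/\ all_tori alpha phi =
        \bigcup_(n in [set n : nat | (0 < n)%N]) tori alpha phi n m,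
      forall n : nat, (0 < n)%N -> finite_set (tori alpha phi n m) &
      (fun n : nat => (n%:R^-1 * ln (#|` fset_set (tori alpha phi n m)|%:R))%:E)
        @ \oo --> htop phi].
Proof.
move=> phi; have [G [uG G1 Gh]] := linearization alpha A_GL2 A_hyp h_cont.
have [W [d [Wu WA d0 d01]]] := hyperbolic_diag A_GL2 A_hyp.
have [] := tori_count (alpha := alpha) (h := h) Wu WA d0 d01 m_gt0
  (invariant_torusP m_gt0 m_int m_min uG G1 Gh A_GL2 A_hyp)
  (torus_of_eq m_gt0 m_int G1).
move=> finT [a [b [a0 ab]]]; split.
- exact: (all_toriE m_gt0 m_int m_min uG G1 Gh A_GL2 A_hyp).
- by move=> n _; exact: finT.
- rewrite (htop_skew_product uG Gh Wu WA d0 d01).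
  apply: cvg_EFin; first exact: nearW.
  exact: (cvg_log_squeeze a0 (lt_trans ltr01 d0) ab).
Qed.
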